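(* Let $H$ be a Krull monoid with class group $G$ and suppose that $$G_{\mathcal P}=\{e_0,\dots,e_r,-e_0,\dots,-e_r\}\subset G$$ is the set of classes containing prime divisors, where $r,\alpha\in\mathbb N$ with $r+\alpha>2$ and $(e_1,\dots,e_r)$ is an independent family of elements each having infinite order such that $e_1+\dots+e_r=\alpha e_0$. Then: (1) $\mathcal A(G_{\mathcal P})=\{V,-V,U_\nu : \nu\in[0,r]\}$, where $V=(-e_0)^\alpha e_1\cdots e_r$ and $U_\nu=(-e_\nu)e_\nu$ for all $\nu\in[0,r]$. In particular, $\mathsf D(G_{\mathcal P})=r+\alpha$. (2) Suppose that $S=\prod_{i=0}^r e_i^{k_i}(-e_i)^{l_i}\in\mathcal F(G_{\mathcal P})$, where $k_0,l_0,\dots,k_r,l_r\in\mathbb N_0$. Then $S\in\mathcal B(G_{\mathcal P})$ if and only if $l_i=\alpha^{-1}(k_0-l_0)+k_i$ for all $i\in[1,r]$. If $S\in\mathcal B(G_{\mathcal P})$ with $k_0\ge l_0$ and $k^*=\min\{k_1,\dots,k_r\}$, then $$\mathsf Z(S)=\Big\{V^\nu(-V)^{\alpha^{-1}(k_0-l_0)+\nu}U_0^{l_0-\alpha\nu}\prod_{i=1}^rU_i^{k_i-\nu} : \nu\in[0,\min\{\alpha^{-1}l_0,k^*\}]\Big\}$$ and $$\mathsf L(S)=\{\alpha^{-1}(k_0-l_0)+l_0+k_1+\dots+k_r-(r+\alpha-2)\nu : \nu\in[0,\min\{\alpha^{-1}l_0,k^*\}]\}.$$ (3) The system of sets of lengths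 of $H$ can be described as follows. (a) $\Delta(H)=\{r+\alpha-2\}$. (b) $\rho(H)=\mathsf D(G_{\mathcal P})/2$. (c) For each $k\in\mathbb N$, the set $\mathcal U_k(H)$ is an arithmetical progression with difference $r+\alpha-2$. (d) For each $k\in\mathbb N$ and each $j\in[0,1]$, $\rho_{2k+j}(H)=k\,\mathsf D(G_{\mathcal P})+j$. (e) For each $l\in\mathbb N_0$, $\lambda_{l\mathsf D(G_{\mathcal P})+j}(H)=2l+j$ whenever $j\in[0,\mathsf D(G_{\mathcal P})-1]$ and $l\,\mathsf D(G_{\mathcal P})+j\ge1$. (f) $\mathcal L(H)=\big\{m+\{2k^*+(r+\alpha-2)\lambda : \lambda\in[0,k^*]\} : m,k^*\in\mathbb N_0\big\}$. (4) $\mathsf c(H)=\mathsf c_{\rm mon}(H)=\omega(H)=\mathsf t(H)=\mathsf D(G_{\mathcal P})=r+\alpha$.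
   Context: $[a,b]$ denotes the set of integers $x$ with $a\le x\le b$ ($a,b$ real). Monoids are commutative, cancellative, with identity. A divisor theory of $H$ is a homomorphism $\varphi:H\to\mathcal F(\mathcal P)$ into a free abelian monoid with basis $\mathcal P$ such that $\varphi(a)\mid\varphi(b)$ implies $a\mid b$ and every $a\in\mathcal F(\mathcal P)$ is the gcd of $\varphi(X)$ for some finite nonempty $X\subset H$. $H$ is Krull if it has a divisor theory (unique up to isomorphism); its class group, written additively, is $G=\mathsf q(\mathcal F(\mathcal P))/\mathsf q(\varphi(H))$, and the set of classes containing prime divisors is $G_{\mathcal P}=\{[p]:p\in\mathcal P\}$. A family $(e_i)$ in an abelian group is independent if all $e_i\ne0$ and $\sum m_ie_i=0$ (with $m_i\in\mathbb Z$) implies $m_ie_i=0$ for all $i$. Zero-sum sequences: for a subset $G_0$ of an abelian group, $\mathcal F(G_0)$ is the (multiplicative) free abelian monoid on $G_0$; for $S=g_1\cdots g_l$ put $|S|=l$, $\sigma(S)=g_1+\dots+g_l$, $-S=(-g_1)\cdots(-g_l)$. $\mathcal B(G_0)=\{S\in\mathcal F(G_0):\sigma(S)=0\}$, $\mathcal A(G_0)$ is the set of its atoms, and $\mathsf D(G_0)=\sup\{|U|:U\in\mathcal A(G_0)\}$. In (2), $\mathsf Z(S)$ and $\mathsf L(S)$ are taken in $\mathcal B(G_{\mathcal P})$. Factorizations: $H_{\rm red}=H/H^\times$, $\mathsf Z(H)=\mathcal F(\mathcal A(H_{\rm red}))$, $\pi:\mathsf Z(H)\to H_{\rm red}$ the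 canonical homomorphism, $\mathsf Z(a)=\pi^{-1}(aH^\times)$, $\mathsf L(a)=\{|z|:z\in\mathsf Z(a)\}$, $\mathcal L(H)=\{\mathsf L(a):a\in H\}$. For $L\subset\mathbb Z$, $\Delta(L)$ is the set of differences $d>0$ of consecutive elements of $L$; $\Delta(H)=\bigcup_{L\in\mathcal L(H)}\Delta(L)$. $\mathcal U_k(H)$ is the union of all $L\in\mathcal L(H)$ with $k\in L$; $\rho_k(H)=\sup\mathcal U_k(H)$, $\lambda_k(H)=\min\mathcal U_k(H)$; $\rho(H)=\sup\{\sup L/\min L:L\in\mathcal L(H),L\neq\{0\}\}$. Arithmetical progressions with difference $d$ are sets $\{a,a+d,\dots,a+ld\}$, $l\in\mathbb N_0$. For $z,z'\in\mathsf Z(H)$ with $g=\gcd(z,z')$, $\mathsf d(z,z')=\max\{|zg^{-1}|,|z'g^{-1}|\}$. $\mathsf c(a)$ (resp. $\mathsf c_{\rm mon}(a)$) is the smallest $N\in\mathbb N_0\cup\{\infty\}$ such that any $z,z'\in\mathsf Z(a)$ can be joined by a sequence $z=z_0,\dots,z_k=z'$ in $\mathsf Z(a)$ with $\mathsf d(z_{i-1},z_i)\le N$ for all $i$ (resp. additionally $|z_0|\le\dots\le|z_k|$ or $|z_0|\ge\dots\ge|z_k|$); $\mathsf c(H)$, $\mathsf c_{\rm mon}(H)$ are the suprema over $a\in H$. For an atom $u$, $\omega(H,u)$ is the smallest $N$ such that whenever $u\mid v_1\cdots v_n$ with atoms $v_i$, there is $\Omega\subset[1,n]$, $|\Omega|\le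 N$, with $u\mid\prod_{\nu\in\Omega}v_\nu$; $\omega(H)=\sup_u\omega(H,u)$. $\mathsf t(H,u)$ is the smallest $N\in\mathbb N_0\cup\{\infty\}$ such that for every multiple $a$ of $u$ and every factorization $a=v_1\cdots v_n$ into atoms not containing $u$ (up to associates), there is, after renumbering, a subproduct $v_1\cdots v_m$ divisible by $u$ and a refactorization $v_1\cdots v_m=uu_2\cdots u_\ell$ into atoms with $\max\{\ell,m\}\le N$; $\mathsf t(H)=\sup_u\mathsf t(H,u)$. *)

(* Defs.v *)
From HB Require Import structures.
From mathcomp Require Import all_boot all_order all_algebra.
From mathcomp Require Import generic_quotient ring_quotient.
From mathcomp Require Import finmap multiset.
From mathcomp Require Import boolp classical_sets reals constructive_ereal ereal.

Set Implicit Arguments.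
Unset Strict Implicit.
Unset Printing Implicit Defensive.

Import Order.TTheory GRing.Theory Num.Theory.

Local Open Scope quotient_scope.
Local Open Scope mset_scope.
Local Open Scope classical_set_scope.
Local Open Scope ring_scope.

(* Commutative monoids are [nmodType]s, so the monoid operation is written
   additively throughout: [a + b] is the product, [a *+ n] the power, [0] the
   identity. *)

Section Monoids.
Variable M : nmodType.
Implicit Types a b u : M.

Definition cancellative : Prop := forall a b c : M, a + b = a + c -> b = c.

Definition mdvd a b : Prop := exists c, b = a + c.

Definition munit a : Prop := exists b, a + b = 0.

Definition matom u : Prop :=
  ~ munit u /\ forall a b, u = a + b -> munit a \/ munit b.

End Monoids.

(* The free abelian monoid with basis [K] is the type {mset K} of finite
   multisets; [mset x] is the basis element x. *)
Section FreeAbelianMonoid.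
Variable K : choiceType.
Implicit Types S T : {mset K}.

HB.instance Definition _ := Choice.on {mset K}.
HB.instance Definition _ :=
  GRing.isNmodule.Build {mset K} msetDA msetDC mset0D.

(* F(X) for a subset X of K, as a submonoid of F(K). *)
Definition Fab (X : set K) : set {mset K} :=
  [set S | forall x, x \in S -> X x].

Definition mlength S : nat := size (S : seq K).

(* The intersection of multisets is the gcd in the free abelian monoid. *)
Definition fdist S T : nat :=
  maxn (mlength (S `\` (S `&` T))%mset) (mlength (T `\` (S `&` T))%mset).

End FreeAbelianMonoid.

Definition mset_map (K L : choiceType) (f : K -> L) (S : {mset K}) : {mset L} :=
  \sum_(x <- (S : seq K)) [mset (f x)].

(* [mred] is the reduced monoid M / M^x: two elements are identified when they
   differ by a unit. *)
Section Reduced.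
Variable M : nmodType.
Implicit Types a b c : M.

Definition massoc a b : bool := `[< exists2 e : M, munit e & b = a + e >].

Fact massoc_refl : reflexive massoc.
Proof.
move=> a; apply/asboolP; exists 0; last by rewrite addr0.
by exists 0; rewrite addr0.
Qed.

Fact massoc_sym : symmetric massoc.
Proof.
suff h a b : massoc a b -> massoc b a by move=> a b; apply/idP/idP; apply: h.
move=> /asboolP[e [f ef] ->]; apply/asboolP; exists f.
  by exists e; rewrite addrC.
by rewrite -addrA ef addr0.
Qed.

Fact massoc_trans : transitive massoc.
Proof.
move=> b a c /asboolP[e [e' ee'] ->] /asboolP[f [f' ff'] ->].
apply/asboolP; exists (e + f); last by rewrite addrA.
by exists (e' + f'); rewrite addrACA ee' ff' addr0.
Qed.

Canonical massoc_equiv := EquivRel massoc massoc_refl massoc_sym massoc_trans.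
Canonical massoc_encModRel := defaultEncModRel massoc.

Definition mred : Type := {eq_quot massoc}.
HB.instance Definition _ := Choice.on mred.
HB.instance Definition _ : EqQuotient M massoc mred := EqQuotient.on mred.

Definition mred0 : mred := lift_cst mred 0.
Definition mredD : mred -> mred -> mred := lift_op2 mred +%R.

Canonical pi_mred0_morph := PiConst mred0.

Fact pi_mredD : {morph \pi_mred : a b / a + b >-> mredD a b}.
Proof.
move=> a b; unlock mredD; apply/eqP; rewrite piE; apply/asboolP.
have /eqmodP/asboolP[e [e' ee'] ->] := esym (reprK (\pi_mred a)).
have /eqmodP/asboolP[f [f' ff'] ->] := esym (reprK (\pi_mred b)).
exists (e + f); last by rewrite addrACA.
by exists (e' + f'); rewrite addrACA ee' ff' addr0.
Qed.
Canonical pi_mredD_morph := PiMorph2 pi_mredD.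

Fact mredDA : associative mredD.
Proof. by move=> x y z; rewrite -[x]reprK -[y]reprK -[z]reprK !piE addrA. Qed.

Fact mredDC : commutative mredD.
Proof. by move=> x y; rewrite -[x]reprK -[y]reprK !piE addrC. Qed.

Fact mred0D : left_id mred0 mredD.
Proof. by move=> x; rewrite -[x]reprK !piE add0r. Qed.

HB.instance Definition _ := GRing.isNmodule.Build mred mredDA mredDC mred0D.

Definition mred_class a : mred := \pi_mred a.

End Reduced.

(* [qgroup] is the quotient group q(M), a pair (a, b) standing for a - b.
   The extra summand [c] makes the relation transitive without assuming
   cancellation; it can be dropped when M is cancellative. *)
Section QuotientGroup.
Variable M : nmodType.
Implicit Types x y z : M * M.

Definition qequiv x y : bool :=
  `[< exists c : M, x.1 + y.2 + c = y.1 + x.2 + c >].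

Fact qequiv_refl : reflexive qequiv.
Proof. by move=> x; apply/asboolP; exists 0. Qed.

Fact qequiv_sym : symmetric qequiv.
Proof.
suff h x y : qequiv x y -> qequiv y x by move=> x y; apply/idP/idP; apply: h.
by move=> /asboolP[c e]; apply/asboolP; exists c.
Qed.

Fact qequiv_trans : transitive qequiv.
Proof.
move=> y x z /asboolP[c e] /asboolP[d f]; apply/asboolP.
exists (y.2 + y.1 + c + d).
rewrite (AC (2*4) ((1*3*5)*(4*2*6)))/= e f.
by rewrite (AC (3*3) ((4*2)*(5*1*3*6)))/=.
Qed.

Canonical qequiv_equiv := EquivRel qequiv qequiv_refl qequiv_sym qequiv_trans.
Canonical qequiv_encModRel := defaultEncModRel qequiv.

Definition qgroup : Type := {eq_quot qequiv}.
HB.instance Definition _ := Choice.on qgroup.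
HB.instance Definition _ : EqQuotient (M * M)%type qequiv qgroup :=
  EqQuotient.on qgroup.

Definition qopp0 x : M * M := (x.2, x.1).
Definition qadd0 x y : M * M := (x.1 + y.1, x.2 + y.2).

Definition qzero : qgroup := lift_cst qgroup (0, 0).
Definition qopp : qgroup -> qgroup := lift_op1 qgroup qopp0.
Definition qadd : qgroup -> qgroup -> qgroup := lift_op2 qgroup qadd0.

Canonical pi_qzero_morph := PiConst qzero.

Fact pi_qopp : {morph \pi_qgroup : x / qopp0 x >-> qopp x}.
Proof.
move=> x; unlock qopp; apply/eqP; rewrite piE; apply/asboolP.
have /eqmodP/asboolP[c e] := reprK (\pi_qgroup x).
by exists c => /=; rewrite [x.2 + _]addrC [_ + x.1]addrC.
Qed.
Canonical pi_qopp_morph := PiMorph1 pi_qopp.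

Fact pi_qadd : {morph \pi_qgroup : x y / qadd0 x y >-> qadd x y}.
Proof.
move=> x y; unlock qadd; apply/eqP; rewrite piE; apply/asboolP.
have /eqmodP/asboolP[c e] := esym (reprK (\pi_qgroup x)).
have /eqmodP/asboolP[d f] := esym (reprK (\pi_qgroup y)).
exists (c + d) => /=.
rewrite (AC (2*2*2) ((1*3*5)*(2*4*6)))/= e f.
by rewrite (AC (3*3) (1*4*(2*5)*(3*6)))/=.
Qed.
Canonical pi_qadd_morph := PiMorph2 pi_qadd.

Fact qaddA : associative qadd.
Proof.
move=> x y z; rewrite -[x]reprK -[y]reprK -[z]reprK !piE /qadd0 /=.
by rewrite !addrA.
Qed.

Fact qaddC : commutative qadd.
Proof.
move=> x y; rewrite -[x]reprK -[y]reprK !piE /qadd0.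
by rewrite addrC [(repr y).2 + _]addrC.
Qed.

Fact qadd0q : left_id qzero qadd.
Proof.
move=> x; rewrite -[x]reprK !piE /qadd0 /= !add0r.
by case: (repr x).
Qed.

Fact qaddN : left_inverse qzero qopp qadd.
Proof.
move=> x; rewrite -[x]reprK !piE; apply/eqmodP/asboolP; exists 0 => /=.
by rewrite !addr0 !add0r addrC.
Qed.

HB.instance Definition _ := GRing.isZmodule.Build qgroup qaddA qaddC qadd0q qaddN.

Definition qemb (a : M) : qgroup := \pi_qgroup (a, 0).

Fact qemb_nmod_morphism : nmod_morphism qemb.
Proof.
split=> [|a b]; first by rewrite /qemb -[RHS]/qzero piE.
by rewrite /qemb -[RHS]/(qadd _ _) -pi_qadd /qadd0 /= addr0.
Qed.
HB.instance Definition _ :=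
  GRing.isNmodMorphism.Build M qgroup qemb qemb_nmod_morphism.

End QuotientGroup.

Section DivisorTheory.
Variables (H : nmodType) (P : choiceType).

Definition is_mgcd (F : nmodType) (d : F) (X : set F) : Prop :=
  (forall x, X x -> mdvd d x) /\
  (forall c, (forall x, X x -> mdvd c x) -> mdvd c d).

Definition divisor_theory (phi : {additive H -> {mset P}}) : Prop :=
  (forall a b, mdvd (phi a) (phi b) -> mdvd a b) /\
  (forall D : {mset P}, exists X : {fset H},
     X != fset0 /\ is_mgcd D [set phi x | x in [set` X]]).

Variable phi : {additive H -> {mset P}}.

Definition qimage : {pred qgroup {mset P}} :=
  fun x => `[< exists a b : H, x = qemb (phi a) - qemb (phi b) >].

Fact qimage_zmod_closed : zmod_closed qimage.
Proof.
split; first by apply/asboolP; exists 0, 0; rewrite subrr.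
move=> x y /asboolP[a [b ->]] /asboolP[c [d ->]]; apply/asboolP.
exists (a + d), (b + c); rewrite !raddfD /= opprK.
by rewrite (AC (2*2) (1*4*(2*3))).
Qed.
HB.instance Definition _ :=
  GRing.isZmodClosed.Build _ qimage qimage_zmod_closed.

(* The class group q(F(P)) / q(phi(H)). *)
Definition class_group : zmodType := Quotient.quot qimage.

Definition prime_class (p : P) : class_group :=
  \pi_(Quotient.quot qimage) (qemb [mset p]).

Definition prime_classes : set class_group := range prime_class.

End DivisorTheory.

Arguments prime_class {H P} phi p.
Arguments prime_classes {H P} phi.

Section ZeroSumSequences.
Variable G : zmodType.
Implicit Type S : {mset G}.

Definition sigma S : G := \sum_(g <- (S : seq G)) g.

Definition mset_opp S : {mset G} := mset_map -%R S.

Definition zero_sum (G0 : set G) : set {mset G} := Fab G0 `&` [set S | sigma S = 0].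

Definition zero_sum_pred (G0 : set G) : {pred {mset G}} := fun S => `[< zero_sum G0 S >].

Fact zero_sum_nmod_closed (G0 : set G) : Algebra.nmod_closed (zero_sum_pred G0).
Proof.
split.
  apply/asboolP; split=> [x|]; first by rewrite in_mset0.
  by apply: big1_seq => x; rewrite /= in_mset0.
move=> S T /asboolP[S1 S2] /asboolP[T1 T2]; apply/asboolP; split=> [x|].
  by rewrite in_msetD => /orP[/S1|/T1].
have perm_msetD (A B : {mset G}) :
    perm_eq ((A `+` B)%mset : seq G) ((A : seq G) ++ (B : seq G)).
  by apply/allP => a _ /=; rewrite count_cat !count_mem_mset msetE2.
rewrite /= /sigma (perm_big _ (perm_msetD S T)) big_cat /=.
by rewrite -!/(sigma _) S2 T2 addr0.
Qed.

(* The monoid B(G0) as a type, [val] being the inclusion into F(G0). *)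
Record zero_sum_monoid (G0 : set G) :=
  ZeroSum { zs_val : {mset G}; _ : zero_sum_pred G0 zs_val }.

HB.instance Definition _ (G0 : set G) := [isSub for @zs_val G0].
HB.instance Definition _ (G0 : set G) := [Choice of zero_sum_monoid G0 by <:].
HB.instance Definition _ (G0 : set G) :=
  GRing.SubChoice_isSubNmodule.Build {mset G} (zero_sum_pred G0)
    (zero_sum_monoid G0) (zero_sum_nmod_closed G0).

Definition zero_sum_atoms (G0 : set G) : set {mset G} :=
  [set val U | U in @matom (zero_sum_monoid G0)].

End ZeroSumSequences.

Definition infinite_order (G : zmodType) (x : G) : Prop :=
  forall n : nat, x *+ n = 0 -> n = 0%N.

Definition independent (G : zmodType) (I : finType) (e : I -> G) : Prop :=
  (forall i, e i <> 0) /\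
  (forall m : I -> int, \sum_i e i *~ m i = 0 -> forall i, e i *~ m i = 0).

Section Factorizations.
Variable H : nmodType.
Implicit Types a u : H.

Definition factorization_monoid : set {mset (mred H)} := Fab (@matom (mred H)).

Definition fact_value (z : {mset (mred H)}) : mred H :=
  \sum_(x <- (z : seq (mred H))) x.

Definition factorizations a : set {mset (mred H)} :=
  factorization_monoid `&` [set z | fact_value z = mred_class a].

Definition lengths a : set nat := @mlength _ @` factorizations a.

Definition length_system : set (set nat) := range lengths.

End Factorizations.

(* Factorizations of a zero-sum sequence S in B(G0): as B(G0) is reduced, each
   class in the reduced monoid is the class of exactly one sequence, and is
   replaced by that sequence. *)
Definition zero_sum_factorizations (G : zmodType) (G0 : set G) (S : {mset G}) :
    set {mset {mset G}} :=
  [set z' | exists2 b : zero_sum_monoid G0, val b = S &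
     exists2 z, factorizations b z &
       z' = mset_map (fun x : mred (zero_sum_monoid G0) => val (repr x)) z].

Definition zero_sum_lengths (G : zmodType) (G0 : set G) (S : {mset G}) :
    set nat :=
  [set n | exists2 b : zero_sum_monoid G0, val b = S & lengths b n].

Definition distances (L : set nat) : set nat :=
  [set d | (0 < d)%N /\ exists n, [/\ L n, L (n + d)%N &
     forall m, L m -> ~ (n < m < n + d)%N]].

Definition is_min (L : set nat) (m : nat) : Prop :=
  L m /\ forall n, L n -> (m <= n)%N.

Definition is_AP (d : nat) (L : set nat) : Prop :=
  exists a l : nat, L = [set (a + d * i)%N | i in [set i | (i <= l)%N]].

Section Arithmetic.
Variables (R : realType) (H : nmodType).
Implicit Types (a u : H) (A : set nat).

(* Suprema and infima of subsets of N_0, with values in the extended reals; the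
   infimum is the minimum if the set is nonempty and +oo otherwise. *)
Definition nat_sup A : \bar R := ereal_sup [set (n%:R)%:E | n in A].
Definition nat_inf A : \bar R := ereal_inf [set (n%:R)%:E | n in A].

Definition distance_set : set nat := \bigcup_(L in length_system H) distances L.

Definition unions_of_lengths (k : nat) : set nat :=
  \bigcup_(L in [set L | length_system H L /\ L k]) L.

Definition rho_ (k : nat) : \bar R := nat_sup (unions_of_lengths k).

Definition lambda_ (k : nat) : \bar R := nat_inf (unions_of_lengths k).

Definition elasticity : \bar R :=
  ereal_sup [set (nat_sup L / nat_inf L)%E |
             L in [set L | length_system H L /\ L <> [set 0%N]]].

Definition fact_chain a (N : nat) (z z' : {mset (mred H)})
    (s : seq {mset (mred H)}) : Prop :=
  [/\ forall y, y \in z :: s -> factorizations a y,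
      path (fun x y => fdist x y <= N)%N z s & last z s = z'].

Definition catenary_bound a (N : nat) : Prop :=
  forall z z', factorizations a z -> factorizations a z' ->
    exists s, fact_chain a N z z' s.

Definition mon_catenary_bound a (N : nat) : Prop :=
  forall z z', factorizations a z -> factorizations a z' ->
    exists s, fact_chain a N z z' s /\
      (sorted leq (map (@mlength _) (z :: s)) \/
       sorted geq (map (@mlength _) (z :: s))).

Definition catenary_degree : \bar R :=
  ereal_sup (range (fun a => nat_inf (catenary_bound a))).

Definition mon_catenary_degree : \bar R :=
  ereal_sup (range (fun a => nat_inf (mon_catenary_bound a))).

Definition omega_bound u (N : nat) : Prop :=
  forall (n : nat) (v : 'I_n -> H), (forall i, matom (v i)) ->
    mdvd u (\sum_i v i) ->
    exists2 Omega : {set 'I_n}, (#|Omega| <= N)%N &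
      mdvd u (\sum_(i in Omega) v i).

Definition omega_invariant : \bar R :=
  ereal_sup [set nat_inf (omega_bound u) | u in @matom H].

(* Here [w] lists the atoms u_2, ..., u_l of the refactorization, so that
   l = size w + 1, and Omega is the set of indices of the subproduct, so that
   m = #|Omega|. *)
Definition tame_bound u (N : nat) : Prop :=
  forall (n : nat) (v : 'I_n -> H), (forall i, matom (v i)) ->
    mdvd u (\sum_i v i) -> (forall i, ~ massoc (v i) u) ->
    exists (Omega : {set 'I_n}) (w : seq H),
      [/\ forall x, x \in w -> matom x,
          \sum_(i in Omega) v i = u + \sum_(x <- w) x &
          (maxn (size w).+1 #|Omega| <= N)%N].

Definition tame_degree : \bar R :=
  ereal_sup [set nat_inf (tame_bound u) | u in @matom H].

End Arithmetic.

Definition davenport (R : realType) (G : zmodType) (G0 : set G) : \bar R :=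
  nat_sup R (@mlength _ @` zero_sum_atoms G0).

(* Main.v *)
Require Import Defs.
From HB Require Import structures.
From mathcomp Require Import all_boot all_order all_algebra.
From mathcomp Require Import generic_quotient ring_quotient.
From mathcomp Require Import finmap multiset.
From mathcomp Require Import boolp classical_sets reals constructive_ereal ereal.
From mathcomp Require Import zify.

Set Implicit Arguments.
Unset Strict Implicit.
Unset Printing Implicit Defensive.

Import Order.TTheory GRing.Theory Num.Theory.

Local Open Scope mset_scope.
Local Open Scope classical_set_scope.
Local Open Scope ring_scope.

(* Counting e_i and -e_i turns sigma(S) = 0 into the equations
   k_0 - l_0 = alpha (l_i - k_i), which show that every nontrivial zero-sum
   sequence is divisible by V, -V or some U_i; as these are pairwise
   incomparable, they are the atoms. Hence a factorization is determined by its
   number of V's, and any two factorizations of a sequence differ by the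
   relation V (-V) = U_0^alpha U_1 ... U_r, which changes the length by
   r + alpha - 2.

   Mapping a prime divisor to its class gives a transfer homomorphism from H to
   B(G_P): a divisor whose class sum is 0 is principal, and decompositions of
   its image lift. So the sets of lengths of H are those of B(G_P). For the
   catenary degree, two factorizations with the same image are joined by
   exchanging two primes of the same class between two atoms (distance 2), and
   the length is raised by applying the relation above (distance r + alpha).
   For omega and the tame degree, an atom u dividing a product of atoms already
   divides the product of at most |u| of them, one for each prime of u. *)

(** Factorizations live in the reduced monoid, while omega and the tame degree speak of divisibility
    in H itself. The axioms of [transfer_map] are therefore chosen so that they hold for H, for its
    reduced monoid and for B(G_P) alike, and one development serves all three. On the reduced monoid
    the map to the free monoid is injective, so products are compared literally; in H a lifted
    product is correct only up to a unit. All lower bounds in (4) come from one element, a lift of V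
    (-V): its factorizations have length 2 or r + alpha only, and each of the r + alpha factors in
    U_0^alpha U_1 ... U_r supplies a single term of V. The upper bound for the tame degree needs
    more than the covering argument, since the complement of u must itself factor into fewer than r
    + alpha atoms. The point is that at most r + alpha atoms which cover V without containing V are
    all of the form U_i, so that their total length, and with it the complement, is small. *)

(** * Free abelian monoids: multiplicities, lengths, distances, images *)

Section MsetTheory.
Variable K : choiceType.
Implicit Types (A B C : {mset K}) (x : K).

Lemma mset_addE A B x : (A + B) x = (A x + B x)%N.
Proof. by rewrite -[LHS]/((A `+` B)%mset x) msetE2. Qed.

Lemma mset_zeroE x : (0 : {mset K}) x = 0%N.
Proof. exact: mset0E. Qed.

Lemma mset_singleE y x : [mset y] x = (x == y) :> nat.
Proof. by rewrite msetnE; case: eqP. Qed.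

Lemma mset_mulrnE A n x : (A *+ n) x = (A x * n)%N.
Proof.
elim: n => [|n IH]; first by rewrite mulr0n mset_zeroE muln0.
by rewrite mulrS mset_addE IH mulnS.
Qed.

Lemma mset_sumE I (s : seq I) (p : pred I) (F : I -> {mset K}) x :
  (\sum_(i <- s | p i) F i) x = (\sum_(i <- s | p i) F i x)%N.
Proof.
by apply: (big_morph (fun A : {mset K} => A x)) => [A B|];
  rewrite ?mset_addE ?mset_zeroE.
Qed.

Lemma mset_addIr A B C : A + B = A + C -> B = C.
Proof.
move=> /msetP e; apply/msetP => x.
by have := e x; rewrite !mset_addE; lia.
Qed.

Lemma mset_dvdP A B : mdvd A B <-> forall x, (A x <= B x)%N.
Proof.
split=> [[C ->] x|h]; first by rewrite mset_addE leq_addr.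
by exists (B `\` A)%mset; symmetry; apply: msetBDKC; apply/msubsetP.
Qed.

Lemma mset_neq0P A : A != 0 -> exists x, x \in A.
Proof. by case: (mset_0Vmem A) => [->|[x]]; [rewrite eqxx|exists x]. Qed.

Lemma mset_pick A x : x \in A -> exists B, A = [mset x] + B.
Proof. by move=> xA; exists (A `\ x)%mset; symmetry; exact: (msetB1K xA). Qed.

Lemma mem_mset_add A B x : (x \in A + B) = (x \in A) || (x \in B).
Proof. exact: in_msetD. Qed.

Lemma mem_mset_single x y : (x \in [mset y]) = (x == y).
Proof. exact: in_mset1. Qed.

Lemma perm_mset_add A B :
  perm_eq ((A + B : {mset K}) : seq K) ((A : seq K) ++ (B : seq K)).
Proof. by apply/allP => a _ /=; rewrite count_cat !count_mem_mset mset_addE. Qed.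

Lemma mlengthD A B : mlength (A + B) = (mlength A + mlength B)%N.
Proof. by rewrite /mlength (perm_size (perm_mset_add A B)) size_cat. Qed.

Lemma mlength0 : mlength (0 : {mset K}) = 0%N.
Proof. exact: size_mset0. Qed.

Lemma mlength1 x : mlength [mset x] = 1%N.
Proof. by rewrite /mlength enum_msetn. Qed.

Lemma mlength_eq0 A : mlength A = 0%N -> A = 0.
Proof. by move=> /eqP; rewrite /mlength size_mset_eq0 => /eqP. Qed.

Lemma mlengthMn A n : mlength (A *+ n) = (mlength A * n)%N.
Proof.
elim: n => [|n IH]; first by rewrite mulr0n mlength0 muln0.
by rewrite mulrS mlengthD IH mulnS.
Qed.

Lemma mlength_sum I (s : seq I) (p : pred I) (F : I -> {mset K}) :
  mlength (\sum_(i <- s | p i) F i) = (\sum_(i <- s | p i) mlength (F i))%N.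
Proof. by apply: (big_morph (@mlength K)) => [A B|]; rewrite ?mlengthD ?mlength0. Qed.

Lemma mset_ind (p : {mset K} -> Prop) :
  p 0 -> (forall x A, p A -> p ([mset x] + A)) -> forall A, p A.
Proof.
move=> p0 pS A; elim: {A}(mlength A) {-2}A (erefl (mlength A)) => [|n IH] A.
  by move/mlength_eq0 ->.
have [->|/mset_neq0P[x /mset_pick[B ->]]] := eqVneq A 0; first by [].
by rewrite mlengthD mlength1 add1n => -[/IH/pS].
Qed.

Lemma mset_dvd_length A B : mdvd A B -> (mlength A <= mlength B)%N.
Proof. by move=> [C ->]; rewrite mlengthD leq_addr. Qed.

Lemma mset_dvd_length_eq A B : mdvd A B -> mlength A = mlength B -> A = B.
Proof.
move=> [C ->]; rewrite mlengthD -[LHS]addn0 => /addnI/esym/mlength_eq0 ->.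
by rewrite addr0.
Qed.

Lemma mset_add_eq0 A B : A + B = 0 -> A = 0 /\ B = 0.
Proof.
move=> /(congr1 (@mlength K)); rewrite mlengthD mlength0 => /eqP.
by rewrite addn_eq0 => /andP[/eqP/mlength_eq0 -> /eqP/mlength_eq0 ->].
Qed.

Lemma Fab0 (X : set K) : Fab X 0.
Proof. by move=> x; rewrite in_mset0. Qed.

Lemma FabD (X : set K) A B : Fab X (A + B) <-> Fab X A /\ Fab X B.
Proof.
split=> [h|[h g] x].
  by split=> x xA; apply: h; rewrite mem_mset_add xA ?orbT.
by rewrite mem_mset_add => /orP[/h|/g].
Qed.

Lemma Fab1 (X : set K) x : Fab X [mset x] <-> X x.
Proof.
split=> [h|h y]; first by apply: h; rewrite mem_mset_single.
by rewrite mem_mset_single => /eqP ->.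
Qed.

Lemma Fab_sum (X : set K) I (s : seq I) (p : pred I) (F : I -> {mset K}) :
  (forall i, p i -> Fab X (F i)) -> Fab X (\sum_(i <- s | p i) F i).
Proof.
by move=> h; apply: big_ind => //; [exact: Fab0|move=> A B hA hB; apply/FabD].
Qed.

Lemma FabMn (X : set K) A n : Fab X A -> Fab X (A *+ n).
Proof.
move=> h; elim: n => [|n IH]; first by rewrite mulr0n; exact: Fab0.
by rewrite mulrS; apply/FabD.
Qed.

Lemma fdist_addl A B C : fdist (A + B) (A + C) = fdist B C.
Proof.
have -> : (A + B) = (A `+` B)%mset by [].
have -> : (A + C) = (A `+` C)%mset by [].
by rewrite /fdist -msetDIr !msetBDl.
Qed.

Lemma fdistC A B : fdist A B = fdist B A.
Proof. by rewrite /fdist maxnC msetIC. Qed.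

(** Together with [fdist_addl], this bounds the cost of replacing a part of a factorization by the
    lengths of the old and the new part. *)
Lemma fdist_le A B : (fdist A B <= maxn (mlength A) (mlength B))%N.
Proof.
have h (X Y : {mset K}) : (mlength (X `\` Y)%mset <= mlength X)%N.
  by apply: mset_dvd_length; apply/mset_dvdP => x; rewrite msetE2 leq_subr.
by rewrite geq_max !leq_max !h orbT.
Qed.

Section Sums.
Variables (V : nmodType) (F : K -> V).

Lemma big_mset_add A B :
  \sum_(x <- (A + B : {mset K})) F x = \sum_(x <- A) F x + \sum_(x <- B) F x.
Proof. by rewrite (perm_big _ (perm_mset_add A B)) big_cat. Qed.

Lemma big_mset_single x : \sum_(y <- [mset x]) F y = F x.
Proof. by rewrite big_msetn. Qed.

Lemma big_mset_zero : \sum_(x <- (0 : {mset K})) F x = 0.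
Proof. exact: big_mset0. Qed.

Lemma big_mset_sum I (s : seq I) (p : pred I) (E : I -> {mset K}) :
  \sum_(x <- (\sum_(i <- s | p i) E i : {mset K})) F x =
  \sum_(i <- s | p i) \sum_(x <- E i) F x.
Proof.
apply: (big_morph (fun A : {mset K} => \sum_(x <- A) F x)) => [A B|].
  exact: big_mset_add.
exact: big_mset_zero.
Qed.

Lemma big_mset_mulrn A n :
  \sum_(x <- (A *+ n : {mset K})) F x = (\sum_(x <- A) F x) *+ n.
Proof.
elim: n => [|n IH]; first by rewrite mulr0n big_mset_zero.
by rewrite !mulrS big_mset_add IH.
Qed.

End Sums.

Lemma mset_sum_single A : \sum_(x <- A) [mset x] = A.
Proof.
elim/mset_ind: A => [|x A IH]; first by rewrite big_mset_zero.
by rewrite big_mset_add big_mset_single IH.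
Qed.

End MsetTheory.

Lemma mem_big_mset (K L : choiceType) (F : K -> {mset L}) (A : {mset K}) (y : L) :
  y \in \sum_(x <- A) F x -> exists2 x, x \in A & y \in F x.
Proof.
elim/mset_ind: A => [|x A IH]; first by rewrite big_mset_zero in_mset0.
rewrite big_mset_add big_mset_single mem_mset_add => /orP[yx|/IH[t tA yt]].
  by exists x => //; rewrite mem_mset_add mem_mset_single eqxx.
by exists t => //; rewrite mem_mset_add tA orbT.
Qed.

Section MsetMap.
Variables (K L : choiceType) (f : K -> L).
Implicit Types A B : {mset K}.

Lemma mset_mapD A B : mset_map f (A + B) = mset_map f A + mset_map f B.
Proof. exact: big_mset_add. Qed.

Lemma mset_map0 : mset_map f 0 = 0.
Proof. exact: big_mset_zero. Qed.

Lemma mset_map1 x : mset_map f [mset x] = [mset (f x)].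
Proof. exact: big_mset_single. Qed.

Lemma mset_map_sum I (s : seq I) (p : pred I) (F : I -> {mset K}) :
  mset_map f (\sum_(i <- s | p i) F i) = \sum_(i <- s | p i) mset_map f (F i).
Proof. exact: big_mset_sum. Qed.

Lemma mset_mapMn A n : mset_map f (A *+ n) = mset_map f A *+ n.
Proof. exact: big_mset_mulrn. Qed.

Lemma mlength_map A : mlength (mset_map f A) = mlength A.
Proof.
elim/mset_ind: A => [|x A IH]; first by rewrite mset_map0 !mlength0.
by rewrite mset_mapD mset_map1 !mlengthD !mlength1 IH.
Qed.

Lemma mem_mset_map A y : y \in mset_map f A -> exists2 x, x \in A & f x = y.
Proof.
elim/mset_ind: A => [|x A IH]; first by rewrite mset_map0 in_mset0.
rewrite mset_mapD mset_map1 mem_mset_add mem_mset_single => /orP[/eqP ->|/IH[z zA <-]].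
  by exists x => //; rewrite mem_mset_add mem_mset_single eqxx.
by exists z => //; rewrite mem_mset_add zA orbT.
Qed.

Lemma Fab_map (X : set L) A : Fab X (mset_map f A) <-> Fab (f @^-1` X) A.
Proof.
elim/mset_ind: A => [|x A IH].
  by rewrite mset_map0; split=> _; exact: Fab0.
by rewrite mset_mapD mset_map1 !FabD IH !Fab1.
Qed.

Lemma big_mset_map (V : nmodType) (F : L -> V) A :
  \sum_(y <- mset_map f A) F y = \sum_(x <- A) F (f x).
Proof.
elim/mset_ind: A => [|x A IH]; first by rewrite mset_map0 !big_mset_zero.
by rewrite mset_mapD mset_map1 !big_mset_add !big_mset_single IH.
Qed.

Lemma mset_map_eq0 A : mset_map f A = 0 -> A = 0.
Proof.
by move=> h; apply: mlength_eq0; rewrite -mlength_map h mlength0.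
Qed.

(** Preimages of the elements of [B1] are taken out of [A] one at a time. Every lifting of a
    decomposition along a transfer homomorphism rests on this. *)
Lemma mset_map_split A (B1 B2 : {mset L}) : mset_map f A = B1 + B2 ->
  exists A1 A2, [/\ A = A1 + A2, mset_map f A1 = B1 & mset_map f A2 = B2].
Proof.
elim/mset_ind: B1 A => [|b B1 IH] A.
  by rewrite add0r => h; exists 0, A; rewrite add0r mset_map0.
move=> h; have /mem_mset_map[a /mset_pick[A' eA] fa] : b \in mset_map f A.
  by rewrite h !mem_mset_add mem_mset_single eqxx.
move: h; rewrite eA mset_mapD mset_map1 fa -addrA => /mset_addIr/IH[A1 [A2 [-> <- <-]]].
by exists ([mset a] + A1), A2; rewrite addrA mset_mapD mset_map1 fa.
Qed.

Lemma eq_mset_map (g : K -> L) A : f =1 g -> mset_map f A = mset_map g A.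
Proof. by move=> h; apply: eq_bigr => x _; rewrite h. Qed.

End MsetMap.

Lemma mset_map_id (K : choiceType) (A : {mset K}) : mset_map id A = A.
Proof. exact: mset_sum_single. Qed.

(** Greedy covering, one index for each element of [A]. If the summands chosen so far do not contain
    enough copies of the new element [q], then some summand not yet chosen contains [q], because the
    full sum has enough copies. *)
Lemma mset_cover (K : choiceType) (I : finType) (F : I -> {mset K}) (A : {mset K}) :
  mdvd A (\sum_i F i) ->
  exists2 Om : {set I}, (#|Om| <= mlength A)%N & mdvd A (\sum_(i in Om) F i).
Proof.
elim/mset_ind: A => [_|q A IH dv].
  by exists finset.set0; [rewrite cards0|exists (\sum_(i in finset.set0) F i); rewrite add0r].
have [|Om cOm /mset_dvdP dOm] := IH.
  by apply/mset_dvdP => x; apply: leq_trans ((mset_dvdP _ _).1 dv x); rewrite mset_addE leq_addl.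
rewrite mlengthD mlength1 add1n.
have [lt|ge] := ltnP (A q) ((\sum_(i in Om) F i)%R q).
  exists Om; first exact: leqW.
  apply/mset_dvdP => x; rewrite mset_addE mset_singleE.
  by have [->|_] := eqVneq x q; [rewrite add1n|exact: dOm].
have [i iOm iq] : exists2 i, i \notin Om & (0 < F i q)%N.
  apply: contrapT => hn; have E0 : (\sum_(i | i \notin Om) F i q = 0)%N.
    apply: big1 => i iOm; apply/eqP; rewrite -leqn0 leqNgt; apply/negP => iq.
    by apply: hn; exists i.
  have := (mset_dvdP _ _).1 dv q; rewrite mset_addE mset_singleE eqxx mset_sumE.
  by rewrite (bigID (mem Om)) /= E0; move: ge; rewrite mset_sumE; lia.
exists (i |: Om)%SET; first by rewrite cardsU1 iOm add1n ltnS.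
apply/mset_dvdP => x; rewrite big_setU1 //= !mset_addE mset_singleE.
by apply: leq_add; [have [->|] := eqVneq x q|exact: dOm].
Qed.

(** * Zero-sum sequences over the classes e_i and -e_i *)

Section SpecialSequences.
Variables (G : zmodType) (r alpha : nat).

Definition pm_classes (e : 'I_r.+1 -> G) : set G :=
  range e `|` range (fun i => - e i).

Definition seqV (e : 'I_r.+1 -> G) : {mset G} :=
  [mset (- e ord0)] *+ alpha + \sum_(i < r) [mset (e (lift ord0 i))].

Definition seqU (e : 'I_r.+1 -> G) (nu : 'I_r.+1) : {mset G} :=
  [mset (- e nu)] + [mset (e nu)].

Definition seqE (e : 'I_r.+1 -> G) (k l : 'I_r.+1 -> nat) : {mset G} :=
  \sum_(i < r.+1) ([mset (e i)] *+ k i + [mset (- e i)] *+ l i).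

Definition pm_atoms (e : 'I_r.+1 -> G) : set {mset G} :=
  [set seqV e; mset_opp (seqV e)] `|` range (seqU e).

(** The hypotheses of the theorem over an arbitrary group, bundled so that they can be passed on to
    the family of the -e_i. *)
Record special_family (e : 'I_r.+1 -> G) : Prop := SpecialFamily {
  sf_r_gt0 : (0 < r)%N;
  sf_alpha_gt0 : (0 < alpha)%N;
  sf_r_alpha : (2 < r + alpha)%N;
  sf_indep : independent (fun i : 'I_r => e (lift ord0 i));
  sf_inf : forall i : 'I_r, infinite_order (e (lift ord0 i));
  sf_sum : \sum_(i < r) e (lift ord0 i) = e ord0 *+ alpha }.

Lemma mset_opp_seqV (e : 'I_r.+1 -> G) :
  mset_opp (seqV e) = seqV (fun i => - e i).
Proof.
rewrite /mset_opp /seqV mset_mapD mset_mapMn mset_map1 mset_map_sum.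
by congr (_ + _); apply: eq_bigr => i _; rewrite mset_map1.
Qed.

Variable e : 'I_r.+1 -> G.
Hypothesis sf : special_family e.

Let r_gt0 : (0 < r)%N. Proof. by case: sf. Qed.
Let alpha_gt0 : (0 < alpha)%N. Proof. by case: sf. Qed.
Let r_alpha : (2 < r + alpha)%N. Proof. by case: sf. Qed.
Let e_indep : independent (fun i : 'I_r => e (lift ord0 i)).
Proof. by case: sf. Qed.
Let e_inf (i : 'I_r) : infinite_order (e (lift ord0 i)).
Proof. by case: sf => ? ? ? ? h _; exact: h. Qed.
Let e_sum : \sum_(i < r) e (lift ord0 i) = e ord0 *+ alpha.
Proof. by case: sf. Qed.

Local Notation GP := (pm_classes e).
Local Notation V := (seqV e).
Local Notation W := (mset_opp (seqV e)).
Local Notation U := (seqU e).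
Local Notation At := (pm_atoms e).
Local Notation lf := (lift ord0).
Implicit Types (S T : {mset G}) (i j : 'I_r.+1).

Lemma infinite_order_int (x : G) (m : int) : infinite_order x -> x *~ m = 0 -> m = 0.
Proof.
move=> h; case: m => n; first by rewrite -pmulrn => /h ->.
by rewrite NegzE mulrNz -pmulrn => /eqP; rewrite oppr_eq0 => /eqP/h.
Qed.

(** Multiplied by alpha, a relation becomes one between e_1, ..., e_r alone, with coefficients m_0 +
    alpha m_i; these vanish by independence and infinite order. Conversely the equations force all
    m_i with i >= 1 to be equal, and the sum collapses to a multiple of e_0 with coefficient 0. *)
Lemma e_relation (m : 'I_r.+1 -> int) :
  \sum_i e i *~ m i = 0 <-> forall i : 'I_r, m ord0 + alpha%:Z * m (lf i) = 0.
Proof.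
rewrite big_ord_recl; split=> [h i|h].
  have: \sum_(i < r) e (lf i) *~ (m ord0 + alpha%:Z * m (lf i)) = 0.
    under eq_bigr do rewrite mulrzDr [alpha%:Z * _]mulrC mulrzA.
    rewrite big_split /= -!mulrz_suml e_sum pmulrn mulrzAC -mulrzDl.
    by rewrite h mul0rz.
  by move/e_indep.2/(_ i)/infinite_order_int; apply; exact: e_inf.
pose i0 : 'I_r := Ordinal r_gt0.
have mE (t : 'I_r) : m (lf t) = m (lf i0).
  have := h t; have := h i0; move: (m (lf t)) (m (lf i0)) => a b e1 e2.
  have : alpha%:Z * (a - b) = 0 by lia.
  by move/eqP; rewrite mulf_eq0 => /orP[|]; lia.
under eq_bigr do rewrite mE.
rewrite -mulrz_suml e_sum pmulrn -mulrzA -mulrzDr.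
by rewrite h mulr0z.
Qed.

Lemma e_relation_diff (k l : 'I_r.+1 -> nat) :
  \sum_i (e i *+ k i - e i *+ l i) = 0 <->
  forall i : 'I_r, (k ord0 + alpha * k (lf i) = l ord0 + alpha * l (lf i))%N.
Proof.
have -> : \sum_i (e i *+ k i - e i *+ l i) = \sum_i e i *~ ((k i)%:Z - (l i)%:Z).
  by apply: eq_bigr => i _; rewrite mulrzBr !pmulrn.
by rewrite e_relation; split=> h i; have := h i; lia.
Qed.

Lemma other_index (t : 'I_r) : (1 < r)%N -> exists t', t' != t.
Proof.
move=> r1; have [t0|t0] := eqVneq (val t) 0%N.
  by exists (Ordinal r1); rewrite -val_eqE /= t0.
by exists (Ordinal r_gt0); rewrite -val_eqE /= eq_sym.
Qed.

Lemma sum_delta j : \sum_i e i *+ (i == j) = e j.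
Proof.
rewrite (bigD1 j) //= eqxx mulr1n big1 ?addr0 // => i /negPf ->.
by rewrite mulr0n.
Qed.

(** With [e_neq_opp] this makes the 2r + 2 classes pairwise distinct, so that a sequence over them
    amounts to its two vectors of multiplicities. *)
Lemma e_inj : injective e.
Proof.
suff h0 j t : e j = e (lf t) -> j = lf t.
  move=> i j; case: (unliftP ord0 j) => [t ->|->]; first exact: h0.
  by case: (unliftP ord0 i) => [t ->|-> //] /esym/h0/esym.
move=> ejt; have : \sum_i (e i *+ (i == j) - e i *+ (i == lf t)) = 0.
  by rewrite sumrB !sum_delta ejt subrr.
rewrite (e_relation_diff (fun i => i == j) (fun i => i == lf t)) => h.
case: (unliftP ord0 j) h => [s ->|->] h.
  by have := h t; rewrite !eqxx /= (inj_eq lift_inj); case: eqP => [-> //|_] /=; lia.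
(* Now e_0 = e_t. The equation at [t] gives alpha = 1, so r + alpha > 2 provides a second index
   [t'], at which the equation reads 1 = 0. *)
have := h t; rewrite eqxx /= => a1.
have [|t' /negPf t't] := @other_index t; first by lia.
by have := h t'; rewrite eqxx /= (inj_eq lift_inj) t't /=; lia.
Qed.

(** The relation e_i + e_j = 0 has nonnegative coefficients, so an equation of [e_relation_diff]
    that involves e_i equates a positive number with 0. *)
Lemma e_neq_opp i j : e i <> - e j.
Proof.
move=> eij; have : \sum_k (e k *+ ((k == i) + (k == j)) - e k *+ 0) = 0.
  under eq_bigr do rewrite mulr0n subr0 mulrnDr.
  by rewrite big_split /= !sum_delta eij addNr.
rewrite (e_relation_diff (fun k => (k == i) + (k == j))%N (fun=> 0%N)) => h.
case: (unliftP ord0 i) h => [s ->|->] h; first by have := h s; rewrite eqxx /=; nia.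
by have := h (Ordinal r_gt0); rewrite eqxx /=; lia.
Qed.

Lemma e_eq i j : (e i == e j) = (i == j).
Proof. exact: (inj_eq e_inj). Qed.

Lemma opp_e_eq i j : (- e i == - e j) = (i == j).
Proof. by rewrite eqr_opp e_eq. Qed.

Lemma e_eq_opp i j : (e i == - e j) = false.
Proof. by apply/eqP/e_neq_opp. Qed.

Lemma opp_e_eq_e i j : (- e i == e j) = false.
Proof. by rewrite eq_sym e_eq_opp. Qed.

Definition eE := (mset_addE, mset_mulrnE, mset_singleE, mset_sumE,
  e_eq, opp_e_eq, e_eq_opp, opp_e_eq_e).

Lemma GP_e i : GP (e i).
Proof. by left; exists i. Qed.

Lemma GP_opp i : GP (- e i).
Proof. by right; exists i. Qed.

Lemma GP_ext S T : Fab GP S -> Fab GP T ->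
  (forall i, S (e i) = T (e i)) -> (forall i, S (- e i) = T (- e i)) -> S = T.
Proof.
move=> FS FT h g; apply/msetP => x.
have [[[i _ <-]|[i _ <-]]|nx] := pselect (GP x); [exact: h|exact: g|].
have -> : S x = 0%N by apply: mset_eq0P; apply/negP => /FS.
by symmetry; apply: mset_eq0P; apply/negP => /FT.
Qed.

Lemma GP_dvd S T : Fab GP S ->
  (forall i, (S (e i) <= T (e i))%N) -> (forall i, (S (- e i) <= T (- e i))%N) ->
  mdvd S T.
Proof.
move=> FS h g; apply/mset_dvdP => x.
have [[[i _ <-]|[i _ <-]]|nx] := pselect (GP x); [exact: h|exact: g|].
suff -> : S x = 0%N by [].
by apply: mset_eq0P; apply/negP => /FS.
Qed.

Lemma sum_nat_delta (F : 'I_r.+1 -> nat) j : (\sum_i (j == i) * F i = F j)%N.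
Proof.
rewrite (bigD1 j) //= eqxx mul1n big1 ?addn0 // => i; rewrite eq_sym => /negPf ->.
by rewrite mul0n.
Qed.

Lemma seqE_e k l j : seqE e k l (e j) = k j.
Proof.
rewrite /seqE eE; under eq_bigr do rewrite !eE mul0n addn0.
exact: sum_nat_delta.
Qed.

Lemma seqE_opp k l j : seqE e k l (- e j) = l j.
Proof.
rewrite /seqE eE; under eq_bigr do rewrite !eE mul0n add0n.
exact: sum_nat_delta.
Qed.

Lemma Fab_seqE k l : Fab GP (seqE e k l).
Proof.
apply: Fab_sum => i _; apply/FabD; split; apply: FabMn; apply/Fab1.
  exact: GP_e.
exact: GP_opp.
Qed.

Lemma seqE_count S : Fab GP S ->
  seqE e (fun i => S (e i)) (fun i => S (- e i)) = S.
Proof.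
by move=> FS; apply: GP_ext => //; [exact: Fab_seqE|move=> i; rewrite seqE_e|
  move=> i; rewrite seqE_opp].
Qed.

Lemma sigma_seqE k l : sigma (seqE e k l) = \sum_i (e i *+ k i - e i *+ l i).
Proof.
rewrite /sigma big_mset_sum; apply: eq_bigr => i _.
by rewrite big_mset_add !big_mset_mulrn !big_mset_single mulNrn.
Qed.

Lemma zero_sumP S : zero_sum GP S <-> Fab GP S /\ forall i : 'I_r,
  (S (e ord0) + alpha * S (e (lf i)) = S (- e ord0) + alpha * S (- e (lf i)))%N.
Proof.
suff h : Fab GP S -> (sigma S = 0 <-> forall i : 'I_r,
    (S (e ord0) + alpha * S (e (lf i)) = S (- e ord0) + alpha * S (- e (lf i)))%N).
  by split=> -[FS hS]; split=> //; apply/h.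
move=> FS; rewrite -[sigma S](congr1 (@sigma G) (seqE_count FS)) sigma_seqE.
exact: (e_relation_diff (fun i => S (e i)) (fun i => S (- e i))).
Qed.

Lemma lf_neq0 (t : 'I_r) : (lf t == ord0) = false.
Proof. by []. Qed.

Lemma neq0_lf (t : 'I_r) : (ord0 == lf t) = false.
Proof. by []. Qed.

Lemma lf_eq (s t : 'I_r) : (lf s == lf t) = (s == t).
Proof. exact: (inj_eq lift_inj). Qed.

Lemma sum_nat_delta_lf (t : 'I_r) : (\sum_(i < r) (t == i) = 1)%N.
Proof.
rewrite (bigD1 t) //= eqxx big1 ?addn0 // => i; rewrite eq_sym => /negPf ->.
by [].
Qed.

Lemma seqV_e0 : V (e ord0) = 0%N.
Proof. by rewrite /seqV !eE big1 // => i _; rewrite !eE. Qed.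

Lemma seqV_opp0 : V (- e ord0) = alpha.
Proof. by rewrite /seqV !eE eqxx mul1n big1 ?addn0 // => i _; rewrite !eE. Qed.

Lemma seqV_e t : V (e (lf t)) = 1%N.
Proof.
rewrite /seqV !eE mul0n add0n -[RHS](sum_nat_delta_lf t).
by apply: eq_bigr => i _; rewrite !eE lf_eq.
Qed.

Lemma seqV_opp t : V (- e (lf t)) = 0%N.
Proof. by rewrite /seqV !eE lf_neq0 mul0n big1 // => i _; rewrite !eE. Qed.

Lemma seqW_e0 : W (e ord0) = alpha.
Proof.
by rewrite mset_opp_seqV /seqV opprK !eE eqxx mul1n big1 ?addn0 // => i _; rewrite !eE.
Qed.

Lemma seqW_opp0 : W (- e ord0) = 0%N.
Proof. by rewrite mset_opp_seqV /seqV opprK !eE big1 // => i _; rewrite !eE. Qed.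

Lemma seqW_e t : W (e (lf t)) = 0%N.
Proof.
by rewrite mset_opp_seqV /seqV opprK !eE lf_neq0 mul0n big1 // => i _; rewrite !eE.
Qed.

Lemma seqW_opp t : W (- e (lf t)) = 1%N.
Proof.
rewrite mset_opp_seqV /seqV opprK !eE mul0n add0n -[RHS](sum_nat_delta_lf t).
by apply: eq_bigr => i _; rewrite !eE lf_eq.
Qed.

Lemma seqU_e i j : U i (e j) = (j == i).
Proof. by rewrite /seqU !eE. Qed.

Lemma seqU_opp i j : U i (- e j) = (j == i).
Proof. by rewrite /seqU !eE addn0. Qed.

Definition atE := (seqV_e0, seqV_opp0, seqV_e, seqV_opp,
  seqW_e0, seqW_opp0, seqW_e, seqW_opp, seqU_e, seqU_opp).

Lemma ord_caseP (p : 'I_r.+1 -> Prop) :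
  p ord0 -> (forall t : 'I_r, p (lf t)) -> forall i, p i.
Proof. by move=> p0 pS i; case: (unliftP ord0 i) => [t ->|->]. Qed.

Lemma Fab_seqV : Fab GP V.
Proof.
apply/FabD; split; first by apply: FabMn; apply/Fab1; exact: GP_opp.
by apply: Fab_sum => i _; apply/Fab1; exact: GP_e.
Qed.

Lemma Fab_seqW : Fab GP W.
Proof.
apply/Fab_map => x /Fab_seqV[[i _ <-]|[i _ <-]] /=; first exact: GP_opp.
by rewrite opprK; exact: GP_e.
Qed.

Lemma Fab_seqU i : Fab GP (U i).
Proof. by apply/FabD; split; apply/Fab1; [exact: GP_opp|exact: GP_e]. Qed.

Lemma mlengthV : mlength V = (r + alpha)%N.
Proof.
rewrite /seqV mlengthD mlengthMn mlength1 mul1n mlength_sum addnC; congr (_ + _)%N.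
under eq_bigr do rewrite mlength1.
by rewrite sum_nat_const card_ord muln1.
Qed.

Lemma mlengthW : mlength W = (r + alpha)%N.
Proof. by rewrite mlength_map mlengthV. Qed.

Lemma mlengthU i : mlength (U i) = 2.
Proof. by rewrite /seqU mlengthD !mlength1. Qed.

Lemma pm_atomsV : At V. Proof. by left; left. Qed.
Lemma pm_atomsW : At W. Proof. by left; right. Qed.
Lemma pm_atomsU i : At (U i). Proof. by right; exists i. Qed.

Lemma pm_atoms_zero_sum S : At S -> zero_sum GP S.
Proof.
case=> [[->|->]|[i _ <-]]; apply/zero_sumP; split.
- exact: Fab_seqV.
- by move=> t; rewrite !atE; lia.
- exact: Fab_seqW.
- by move=> t; rewrite !atE; lia.
- exact: Fab_seqU.
- by move=> t; rewrite !atE.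
Qed.

Lemma pm_atoms_length S : At S -> (2 <= mlength S <= r + alpha)%N.
Proof. by case=> [[->|->]|[i _ <-]]; rewrite ?mlengthV ?mlengthW ?mlengthU; lia. Qed.

Lemma pm_atoms_neq0 S : At S -> S <> 0.
Proof. by move=> /pm_atoms_length h S0; move: h; rewrite S0 mlength0. Qed.

(** If no U_i divides S, each index occurs with one sign only. If -e_0 occurs, the equation at t
    makes e_t occur and -e_t not, so the multiplicity of -e_0 is alpha times that of e_t, hence at
    least alpha, and V divides S. The case of e_0 is symmetric, and if neither occurs then S is
    empty. *)
Lemma pm_atoms_dvd S : zero_sum GP S -> S <> 0 -> exists2 A, At A & mdvd A S.
Proof.
move=> /zero_sumP[FS hS] S0.
have [[i /andP[h1 h2]]|hn] := pselect (exists i, (0 < S (e i)) && (0 < S (- e i)))%N.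
  exists (U i); first exact: pm_atomsU.
  by apply: GP_dvd => [|j|j]; [exact: Fab_seqU|rewrite atE..]; case: eqP => // ->.
have {}hn i : S (e i) = 0%N \/ S (- e i) = 0%N.
  apply: contrapT => h; apply: hn; exists i; lia.
have [p0|p0] := posnP (S (e ord0)).
  have [n0|n0] := posnP (S (- e ord0)).
    case: S0; apply: GP_ext => //; first exact: Fab0.
      apply: ord_caseP => [|t]; rewrite mset_zeroE //.
      by have := hS t; have := hn (lf t); nia.
    apply: ord_caseP => [|t]; rewrite mset_zeroE //.
    by have := hS t; have := hn (lf t); nia.
  exists V; first exact: pm_atomsV.
  have h t : (0 < S (e (lf t)) /\ alpha <= S (- e ord0))%N.
    have := hS t; rewrite p0; case: (hn (lf t)) => -> ht; first by lia.
    by case: (S (e (lf t))) ht => [|a] ht; split=> //; nia.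
  apply: GP_dvd; first exact: Fab_seqV.
    by apply: ord_caseP => [|t]; rewrite atE ?p0 //; case: (h t).
  by apply: ord_caseP => [|t]; rewrite atE //; case: (h (Ordinal r_gt0)).
exists W; first exact: pm_atomsW.
have h t : (0 < S (- e (lf t)) /\ alpha <= S (e ord0))%N.
  case: (hn ord0) => [|n0]; first by lia.
  have := hS t; rewrite n0; case: (hn (lf t)) => -> ht; last by lia.
  by case: (S (- e (lf t))) ht => [|a] ht; split=> //; nia.
apply: GP_dvd; first exact: Fab_seqW.
  by apply: ord_caseP => [|t]; rewrite atE //; case: (h (Ordinal r_gt0)).
by apply: ord_caseP => [|t]; rewrite atE //; case: (h t).
Qed.

Lemma pm_atoms_anti A B : At A -> At B -> mdvd A B -> A = B.
Proof.
pose t0 : 'I_r := Ordinal r_gt0.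
move=> hA hB /mset_dvdP h.
case: hA hB h => [[->|->]|[i _ <-]] [[->|->]|[j _ <-]] h //.
- by have := h (- e ord0); rewrite !atE; lia.
- have := h (- e ord0); have := h (e (lf t0)); rewrite !atE.
  by have [<-|] := eqVneq (lf t0) j; rewrite ?neq0_lf; lia.
- by have := h (e ord0); rewrite !atE; lia.
- have := h (e ord0); have := h (- e (lf t0)); rewrite !atE.
  by have [<-|] := eqVneq (lf t0) j; rewrite ?neq0_lf; lia.
- by have := h (e i); have := h (- e i); elim/ord_caseP: i {h} => [|t]; rewrite !atE !eqxx.
- by have := h (e i); have := h (- e i); elim/ord_caseP: i {h} => [|t]; rewrite !atE !eqxx.
- by have := h (e i); rewrite !atE eqxx; case: eqP => // ->.
Qed.

End SpecialSequences.

(** * Factorizations and lengths of zero-sum sequences *)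

(** Factorizations written directly in the free monoid, with the set of admissible factors as a
    parameter, so that neither a subtype nor a reduced monoid intervenes. *)
Definition mset_facts (K : choiceType) (At : set {mset K}) (S : {mset K}) :
    set {mset {mset K}} :=
  [set z | Fab At z /\ \sum_(A <- z) A = S].

Definition mset_lengths (K : choiceType) (At : set {mset K}) (S : {mset K}) : set nat :=
  @mlength _ @` mset_facts At S.

(** The sets of (f). In a shortest factorization [k] is the number of disjoint pairs V, -V, which
    can be broken independently, and [m] counts the remaining atoms. *)
Definition length_AP (d m k : nat) : set nat :=
  [set (m + (2 * k + d * n))%N | n in [set n | (n <= k)%N]].

Section ZeroSumFactorizations.
Variables (G : zmodType) (r alpha : nat) (e : 'I_r.+1 -> G).
Hypothesis sf : special_family alpha e.

Let r_gt0 : (0 < r)%N. Proof. by case: sf. Qed.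
Let alpha_gt0 : (0 < alpha)%N. Proof. by case: sf. Qed.
Let r_alpha : (2 < r + alpha)%N. Proof. by case: sf. Qed.

Local Notation GP := (pm_classes e).
Local Notation V := (seqV alpha e).
Local Notation W := (mset_opp (seqV alpha e)).
Local Notation U := (seqU e).
Local Notation At := (pm_atoms alpha e).
Local Notation lf := (lift ord0).
Local Notation d := (r + alpha - 2)%N.
Implicit Types (S : {mset G}) (z : {mset {mset G}}).

Local Notation zfact := (mset_facts At).
Local Notation zlengths := (mset_lengths At).

Definition zform (x y : nat) (u : 'I_r.+1 -> nat) : {mset {mset G}} :=
  [mset V] *+ x + [mset W] *+ y + \sum_i [mset (U i)] *+ u i.

Lemma seqV_neqW : (V == W) = false.
Proof.
by apply/eqP => /msetP/(_ (e ord0)); rewrite !(atE sf); lia.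
Qed.

Lemma seqV_neqU i : (V == U i) = false.
Proof.
by apply/eqP => /msetP E; have := E (e i); have := E (- e i);
  elim/ord_caseP: i {E} => [|t]; rewrite !(atE sf) eqxx.
Qed.

Lemma seqW_neqU i : (W == U i) = false.
Proof.
by apply/eqP => /msetP E; have := E (e i); have := E (- e i);
  elim/ord_caseP: i {E} => [|t]; rewrite !(atE sf) eqxx.
Qed.

Lemma seqU_eq i j : (U i == U j) = (i == j).
Proof.
apply/eqP/eqP => [/msetP/(_ (e i))|-> //].
by rewrite !(atE sf) eqxx; case: eqP.
Qed.

Definition zE := (mset_addE, mset_mulrnE, mset_singleE, mset_sumE, eqxx,
  seqV_neqW, seqV_neqU, seqW_neqU, seqU_eq,
  etrans (eq_sym _ _) seqV_neqW, fun i => etrans (eq_sym _ _) (seqV_neqU i),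
  fun i => etrans (eq_sym _ _) (seqW_neqU i)).

Lemma zform_V x y u : zform x y u V = x.
Proof.
by rewrite /zform !zE mul1n mul0n addn0 big1 ?addn0 // => i _; rewrite !zE.
Qed.

Lemma zform_W x y u : zform x y u W = y.
Proof.
by rewrite /zform !zE mul1n mul0n add0n big1 ?addn0 // => i _; rewrite !zE.
Qed.

Lemma zform_U x y u i : zform x y u (U i) = u i.
Proof.
rewrite /zform !zE !mul0n !add0n -[RHS](sum_nat_delta u).
by apply: eq_bigr => j _; rewrite !zE.
Qed.

Lemma Fab_zform x y u : Fab At (zform x y u).
Proof.
apply/FabD; split; first (apply/FabD; split).
- by apply: FabMn; apply/Fab1; exact: pm_atomsV.
- by apply: FabMn; apply/Fab1; exact: pm_atomsW.
- by apply: Fab_sum => i _; apply: FabMn; apply/Fab1; exact: pm_atomsU.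
Qed.

Lemma zform_count z : Fab At z -> z = zform (z V) (z W) (fun i => z (U i)).
Proof.
move=> Fz; apply/msetP => A.
have [[[->|->]|[i _ <-]]|nA] := pselect (At A).
- by rewrite zform_V.
- by rewrite zform_W.
- by rewrite zform_U.
have -> : z A = 0%N by apply: mset_eq0P; apply/negP => /Fz.
by symmetry; apply: mset_eq0P; apply/negP => /Fab_zform.
Qed.

Lemma zform_sum x y u :
  \sum_(A <- zform x y u) A = V *+ x + W *+ y + \sum_i U i *+ u i.
Proof.
rewrite !big_mset_add !big_mset_mulrn !big_mset_single big_mset_sum.
by congr (_ + _); apply: eq_bigr => i _; rewrite big_mset_mulrn big_mset_single.
Qed.

Lemma mlength_zform x y u : mlength (zform x y u) = (x + y + \sum_i u i)%N.
Proof.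
rewrite /zform !mlengthD !mlengthMn !mlength1 !mul1n mlength_sum; congr (_ + _)%N.
by apply: eq_bigr => i _; rewrite mlengthMn mlength1 mul1n.
Qed.

Lemma zform_sum_e x y u i :
  (V *+ x + W *+ y + \sum_i U i *+ u i) (e i) = (V (e i) * x + W (e i) * y + u i)%N.
Proof.
move: W V => B A; rewrite !mset_addE !mset_mulrnE; congr (_ + _)%N.
rewrite mset_sumE -[RHS](sum_nat_delta u).
by apply: eq_bigr => j _; rewrite mset_mulrnE (atE sf).
Qed.

Lemma zform_sum_opp x y u i :
  (V *+ x + W *+ y + \sum_i U i *+ u i) (- e i) =
  (V (- e i) * x + W (- e i) * y + u i)%N.
Proof.
move: W V => B A; rewrite !mset_addE !mset_mulrnE; congr (_ + _)%N.
rewrite mset_sumE -[RHS](sum_nat_delta u).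
by apply: eq_bigr => j _; rewrite mset_mulrnE (atE sf).
Qed.

Lemma zfact_zero_sum S z : zfact S z -> zero_sum GP S.
Proof.
move=> [Fz <-]; elim/mset_ind: z Fz => [|A z IH].
  by move=> _; rewrite big_mset_zero; apply/asboolP; exact: (zero_sum_nmod_closed GP).1.
move=> /FabD[/Fab1 hA /IH h]; rewrite big_mset_add big_mset_single.
apply/asboolP; apply: (zero_sum_nmod_closed GP).2; apply/asboolP => //.
exact: (pm_atoms_zero_sum sf).
Qed.

(** Being a factorization of [S] amounts to these linear equations; [zfact_counts] is the
    converse. *)
Lemma zform_zfact S x y u : Fab GP S ->
  [/\ S (e ord0) = alpha * y + u ord0, S (- e ord0) = alpha * x + u ord0,
      forall t : 'I_r, S (e (lf t)) = x + u (lf t) &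
      forall t : 'I_r, S (- e (lf t)) = y + u (lf t)]%N ->
  zfact S (zform x y u).
Proof.
move=> FS [h1 h2 h3 h4]; split; first exact: Fab_zform.
have [FT _] : zero_sum GP (\sum_(A <- zform x y u) A).
  by apply: (@zfact_zero_sum _ (zform x y u)); split=> //; exact: Fab_zform.
apply: (GP_ext FT FS).
  by apply: ord_caseP => [|t]; rewrite zform_sum zform_sum_e !(atE sf) ?h1 ?h3; lia.
by apply: ord_caseP => [|t]; rewrite zform_sum zform_sum_opp !(atE sf) ?h2 ?h4; lia.
Qed.

Lemma zfact_counts S z : zfact S z ->
  [/\ S (e ord0) = alpha * z W + z (U ord0), S (- e ord0) = alpha * z V + z (U ord0),
      forall t : 'I_r, S (e (lf t)) = z V + z (U (lf t)) &
      forall t : 'I_r, S (- e (lf t)) = z W + z (U (lf t))]%N.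
Proof.
move=> [/zform_count zE <-]; rewrite {1 4 7 10}zE zform_sum.
by split=> [||t|t]; rewrite ?zform_sum_e ?zform_sum_opp !(atE sf); lia.
Qed.

Lemma zfact_length S z : zfact S z ->
  mlength z = (z V + z W + z (U ord0) + \sum_(t < r) z (U (lf t)))%N.
Proof.
by move=> [/zform_count zE _]; rewrite {1}zE mlength_zform big_ord_recl addnA.
Qed.

Lemma zfact_sumU S z : zfact S z ->
  (\sum_(t < r) z (U (lf t)) + r * z V = \sum_(t < r) S (e (lf t)))%N.
Proof.
move=> /zfact_counts[_ _ h _]; under [RHS]eq_bigr do rewrite h.
by rewrite big_split sum_nat_const card_ord addnC.
Qed.

(** The difference between the numbers of V and of -V depends on [S] alone: alpha times it is l_0 -
    k_0. *)
Lemma zfact_shift S z z' : zfact S z -> zfact S z' ->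
  (z V + z' W = z' V + z W)%N.
Proof.
move=> h h'; have [a1 b1 _ _] := zfact_counts h; have [a2 b2 _ _] := zfact_counts h'.
have : (alpha * (z V + z' W) = alpha * (z' V + z W))%N by rewrite !mulnDr; lia.
by move/eqP; rewrite eqn_pmul2l // => /eqP.
Qed.

(** Expressed through the number of V, the counts of U_0 and of the other U_i fall by alpha and r
    for each V, while that of -V rises by 1. The length therefore falls by d for each V. *)
Lemma zfact_length_V S z z' : zfact S z -> zfact S z' ->
  (mlength z + d * z V = mlength z' + d * z' V)%N.
Proof.
move=> h h'; have := zfact_shift h h'.
have [_ b1 _ _] := zfact_counts h; have [_ b2 _ _] := zfact_counts h'.
have := zfact_sumU h; have := zfact_sumU h'.
rewrite (zfact_length h) (zfact_length h').
move: (\sum_(t < r) _)%N (\sum_(t < r) _)%N (\sum_(t < r) _)%N => s1 s2 s3.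
by rewrite !mulnBl !mulnDl; nia.
Qed.

(** As d > 0, equal lengths force equal numbers of V, and these fix all other multiplicities. *)
Lemma zfact_eq S z z' : zfact S z -> zfact S z' -> mlength z = mlength z' -> z = z'.
Proof.
move=> h h' E; have EV : z V = z' V.
  have /eqP := zfact_length_V h h'; rewrite E eqn_add2l eqn_pmul2l ?subn_gt0 //.
  by move/eqP.
have := zfact_shift h h'; rewrite EV => /addnI EW.
have [a1 b1 c1 _] := zfact_counts h; have [a2 b2 c2 _] := zfact_counts h'.
rewrite (zform_count h.1) (zform_count h'.1) EV -EW; congr zform.
apply/funext; apply: ord_caseP => [|t]; first by move: b1 b2; rewrite EV; lia.
by have := c1 t; have := c2 t; rewrite EV; lia.
Qed.

Lemma zfact0 : zfact 0 0.
Proof. by split; [exact: Fab0|rewrite big_mset_zero]. Qed.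

Lemma zfactD S T z z' : zfact S z -> zfact T z' -> zfact (S + T) (z + z').
Proof.
by move=> [h <-] [g <-]; split; [apply/FabD|rewrite big_mset_add].
Qed.

Lemma zfact1 A : At A -> zfact A [mset A].
Proof. by move=> h; split; [apply/Fab1|rewrite big_mset_single]. Qed.

Lemma zfact_exists S : zero_sum GP S -> exists z, zfact S z.
Proof.
elim: {S}(mlength S) {-2}S (leqnn (mlength S)) => [|n IH] S hn hS.
  have /mlength_eq0 -> : mlength S = 0%N by lia.
  by exists 0; exact: zfact0.
have [->|/eqP S0] := eqVneq S 0; first by exists 0; exact: zfact0.
have [A hA [T E]] := pm_atoms_dvd sf hS S0.
have hT : zero_sum GP T.
  have /(zero_sumP sf)[FA eA] := pm_atoms_zero_sum sf hA.
  move: hS => /(zero_sumP sf); rewrite E => -[/FabD[_ FT] eS]; apply/(zero_sumP sf).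
  by split=> // t; have := eA t; have := eS t; rewrite !mset_addE; lia.
have [|z hz] := IH T _ hT.
  by move: hn; have := pm_atoms_length sf hA; rewrite E mlengthD; lia.
by exists ([mset A] + z); rewrite E; apply: zfactD => //; exact: zfact1.
Qed.

Lemma zfact_break S z n : zfact S z -> (n <= z V)%N -> (n <= z W)%N ->
  zlengths S (mlength z + d * n)%N.
Proof.
move=> h nV nW; have [a1 b1 c1 d1] := zfact_counts h.
(* Each of [n] pairs V, -V is replaced by U_0^alpha U_1 ... U_r. *)
pose w := zform (z V - n) (z W - n)
  (fun i => z (U i) + if i == ord0 then alpha * n else n)%N.
have hw : zfact S w.
  apply: zform_zfact; first by case: (zfact_zero_sum h).
  split=> [||t|t]; rewrite ?eqxx ?lf_neq0.
  - by rewrite a1 mulnBr; nia.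
  - by rewrite b1 mulnBr; nia.
  - by rewrite c1; lia.
  - by rewrite d1; lia.
exists w => //; have := zfact_length_V h hw.
rewrite zform_V mulnBr; have := leq_mul2l d n (z V); rewrite nV orbT; lia.
Qed.

(** A factorization with the most V is a shortest one. Any other lacks n of its V and, by
    [zfact_shift], as many -V; conversely every such n is realized by breaking n pairs. *)
Lemma zlengthsE S z : zfact S z -> (forall z', zfact S z' -> (z' V <= z V)%N) ->
  zlengths S = [set (mlength z + d * n)%N | n in [set n | (n <= minn (z V) (z W))%N]].
Proof.
move=> hz hmax; apply/seteqP; split=> [n [z' hz' <-]|n [k hk <-]].
  have le_min : (z V - z' V <= minn (z V) (z W))%N.
    by have := zfact_shift hz hz'; lia.
  exists (z V - z' V)%N; first exact: le_min.
  have : (d * z' V <= d * z V)%N by rewrite leq_mul2l hmax ?orbT.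
  by have := zfact_length_V hz hz'; rewrite mulnBr; lia.
have {}hk : (k <= minn (z V) (z W))%N := hk.
by apply: zfact_break => //; lia.
Qed.

Lemma zlengths_AP S : zero_sum GP S -> exists m k, zlengths S = length_AP d m k.
Proof.
move=> hS; have [z0 hz0] := zfact_exists hS.
(* The multiplicity of e_1 bounds the number of V, so a factorization with the most V exists. *)
have hb z : zfact S z -> (z V <= S (e (lf (Ordinal r_gt0))))%N.
  by move=> /zfact_counts[_ _ h _]; rewrite h leq_addr.
pose p n := `[< exists2 z, zfact S z & z V = n >].
have ex : exists n, p n by exists (z0 V); apply/asboolP; exists z0.
have ub n : p n -> (n <= S (e (lf (Ordinal r_gt0))))%N.
  by move=> /asboolP[z /hb h <-].
have [n /asboolP[z hz <-] hn] := ex_maxnP ex ub.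
exists (mlength z - 2 * minn (z V) (z W))%N, (minn (z V) (z W)).
rewrite (zlengthsE hz) => [|z' hz']; last by apply: hn; apply/asboolP; exists z'.
by apply: eq_imagel => i _; rewrite (zfact_length hz); lia.
Qed.

Lemma length_AP_ex m k : exists2 S, zero_sum GP S & zlengths S = length_AP d m k.
Proof.
(* The sequence V^k (-V)^k U_0^m contains e_1 exactly k times, so no factorization of it has more
   than k copies of V. *)
pose z := zform k k (fun i => if i == ord0 then m else 0%N).
have hz : zfact (\sum_(A <- z) A) z by split=> //; exact: Fab_zform.
exists (\sum_(A <- z) A); first exact: zfact_zero_sum hz.
rewrite (zlengthsE hz) => [|z' hz'].
  rewrite zform_V zform_W minnn; apply: eq_imagel => i _.
  rewrite (zfact_length hz) zform_V zform_W zform_U eqxx big1 => [|t _].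
    by lia.
  by rewrite zform_U.
have [_ _ /(_ (Ordinal r_gt0)) h1 _] := zfact_counts hz.
have [_ _ /(_ (Ordinal r_gt0)) h2 _] := zfact_counts hz'.
by move: h1 h2; rewrite zform_V zform_U lf_neq0; lia.
Qed.

Section Explicit.
Variables (k l : 'I_r.+1 -> nat).
Local Notation S := (seqE e k l).

Lemma zero_sum_seqE : zero_sum GP S <->
  forall i : 'I_r, (l (lf i))%:R =
    alpha%:R^-1 * ((k ord0)%:R - (l ord0)%:R) + (k (lf i))%:R :> rat.
Proof.
have a0 : alpha%:R != 0 :> rat by rewrite pnatr_eq0 -lt0n.
rewrite (zero_sumP sf); split=> [[_ h] i|h].
  have := h i; rewrite !(seqE_e sf) !(seqE_opp sf) => /(congr1 (fun n => n%:R : rat)).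
  rewrite !natrD !natrM => E; apply: (mulfI a0).
  rewrite mulrDr mulVKf //.
  by rewrite addrAC E addrAC subrr add0r.
split=> [|i]; first exact: Fab_seqE.
rewrite !(seqE_e sf) !(seqE_opp sf); apply/eqP; rewrite -(eqr_nat rat) !natrD !natrM h.
by rewrite mulrDr mulVKf // addrA addrCA subrr addr0.
Qed.

Hypotheses (hS : zero_sum GP S) (lk : (l ord0 <= k ord0)%N).
Variable kstar : nat.
Hypothesis kstarP : is_min (range (fun i : 'I_r => k (lf i))) kstar.
(** The division is exact by [q_mul], so [q] is the number alpha^-1 (k_0 - l_0) of the theorem. *)
Let q := ((k ord0 - l ord0) %/ alpha)%N.
Let J : set nat := [set nu : nat |
  (nu%:R : rat) <= Num.min (alpha%:R^-1 * (l ord0)%:R) kstar%:R].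

Let zs_eq i : (k ord0 + alpha * k (lf i) = l ord0 + alpha * l (lf i))%N.
Proof. by have [_ /(_ i)] := (zero_sumP sf S).1 hS; rewrite !(seqE_e sf) !(seqE_opp sf). Qed.

Let qE i : (l (lf i) = k (lf i) + q)%N.
Proof.
have := zs_eq i; rewrite /q => E.
have -> : (k ord0 - l ord0 = (l (lf i) - k (lf i)) * alpha)%N.
  by rewrite mulnBl; lia.
rewrite mulnK //; suff : (k (lf i) <= l (lf i))%N by lia.
by rewrite -(leq_pmul2l alpha_gt0); lia.
Qed.

Let q_mul : (k ord0 = l ord0 + alpha * q)%N.
Proof. by have := zs_eq (Ordinal r_gt0); rewrite (qE (Ordinal r_gt0)) mulnDr; lia. Qed.

(** Membership in [J] says precisely that the exponents l_0 - alpha nu and k_i - nu are not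
    truncated. *)
Let JP nu : J nu <-> (alpha * nu <= l ord0)%N /\ forall i : 'I_r, (nu <= k (lf i))%N.
Proof.
have -> : J nu <-> (alpha * nu <= l ord0)%N /\ (nu <= kstar)%N.
  rewrite /J /= le_min ler_nat mulrC ler_pdivlMr ?ltr0n // -natrM ler_nat mulnC.
  by split=> [/andP[]|[-> ->]].
case: kstarP => -[i _ <-] hmin; split=> -[-> h]; split=> // j.
by apply: leq_trans h _; apply: hmin; exists j.
Qed.

Let u nu i := (if i == ord0 :> 'I_r.+1 then l ord0 - alpha * nu else k i - nu)%N.

Let zformE nu : [mset V] *+ nu + [mset W] *+ (q + nu)
    + [mset (U ord0)] *+ (l ord0 - alpha * nu)
    + \sum_(i < r) [mset (U (lf i))] *+ (k (lf i) - nu) = zform nu (q + nu) (u nu).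
Proof. by rewrite /zform big_ord_recl addrA. Qed.

Lemma zfact_seqE : zfact S =
  [set [mset V] *+ nu + [mset W] *+ (q + nu) + [mset (U ord0)] *+ (l ord0 - alpha * nu)
       + \sum_(i < r) [mset (U (lf i))] *+ (k (lf i) - nu) | nu in J].
Proof.
apply/seteqP; split=> [z hz|_ [nu /JP[hl hk] <-]]; last first.
  rewrite zformE; apply: zform_zfact; first exact: Fab_seqE.
  split=> [||t|t]; rewrite ?(seqE_e sf) ?(seqE_opp sf) /u ?eqxx ?lf_neq0.
  - by rewrite q_mul mulnDr; lia.
  - by lia.
  - by have := hk t; lia.
  - by rewrite qE; have := hk t; lia.
have := zfact_counts hz; rewrite (seqE_e sf) (seqE_opp sf) => -[h1 h2 h3 h4].
exists (z V).
  by apply/JP; split=> [|i]; [lia|have := h3 i; rewrite (seqE_e sf); lia].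
rewrite zformE [RHS](zform_count hz.1); congr zform.
  have := h4 (Ordinal r_gt0); have := h3 (Ordinal r_gt0).
  by rewrite (seqE_e sf) (seqE_opp sf) qE; lia.
apply/funext; apply: ord_caseP => [|t]; rewrite /u ?eqxx ?lf_neq0; first by lia.
by have := h3 t; rewrite (seqE_e sf); lia.
Qed.

Lemma zlengths_seqE : zlengths S =
  [set (q + l ord0 + \sum_(i < r) k (lf i) - d * nu)%N | nu in J].
Proof.
have lenE nu : J nu -> mlength (zform nu (q + nu) (u nu)) =
    (q + l ord0 + \sum_(i < r) k (lf i) - d * nu)%N.
  move=> /JP[hl hk]; rewrite mlength_zform big_ord_recl /=.
  have -> : (\sum_(i < r) u nu (lf i) = \sum_(i < r) (k (lf i) - nu))%N by [].
  have : (\sum_(i < r) (k (lf i) - nu) + r * nu = \sum_(i < r) k (lf i))%N.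
    rewrite -[X in (_ + X * _)%N](card_ord r) -sum_nat_const -big_split /=.
    by apply: eq_bigr => i _; rewrite subnK.
  have -> : u nu ord0 = (l ord0 - alpha * nu)%N by [].
  move: (\sum_(i < r) _)%N (\sum_(i < r) _)%N => s1 s2.
  by rewrite !mulnBl !mulnDl; nia.
rewrite /mset_lengths zfact_seqE image_comp.
by apply: eq_imagel => nu /lenE <-; rewrite -zformE.
Qed.

End Explicit.
End ZeroSumFactorizations.

(** * Minimal zero-sum sequences *)

Section MinimalZeroSum.
Variables (G : zmodType) (GP : set G).
Implicit Types S T : {mset G}.

(** The atoms of B(G_P) described inside the free monoid; the empty sequence is the only unit.
    [zero_sum_atomsE] identifies them with the atoms of the subtype. *)
Definition min_zero_sum : set {mset G} :=
  [set S | [/\ zero_sum GP S, S <> 0 &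
    forall S1 S2, zero_sum GP S1 -> zero_sum GP S2 -> S = S1 + S2 ->
      S1 = 0 \/ S2 = 0]].

Lemma sigmaD S T : sigma (S + T) = sigma S + sigma T.
Proof. exact: big_mset_add. Qed.

Lemma zero_sum_sub S T : zero_sum GP S -> zero_sum GP (S + T) -> zero_sum GP T.
Proof.
move=> [F1 s1] [/FabD[_ F2]]; rewrite /= sigmaD s1 add0r => s2.
by split.
Qed.

End MinimalZeroSum.

(** A set of nonempty zero-sum sequences consists of all atoms once its members are pairwise
    incomparable and every nonempty zero-sum sequence is divisible by one of them. *)
Lemma min_zero_sum_pm (G : zmodType) (r alpha : nat) (e : 'I_r.+1 -> G) :
  special_family alpha e -> min_zero_sum (pm_classes e) = pm_atoms alpha e.
Proof.
move=> sf; apply/seteqP; split=> S.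
  move=> [hS S0 hmin]; have [A hA [T E]] := pm_atoms_dvd sf hS S0.
  have zA := pm_atoms_zero_sum sf hA.
  have zT : zero_sum (pm_classes e) T by apply: (zero_sum_sub zA); rewrite -E.
  have [A0|T0] := hmin _ _ zA zT E; first by case: (pm_atoms_neq0 sf hA).
  by rewrite E T0 addr0.
move=> hS; split; [exact: (pm_atoms_zero_sum sf)|exact: (pm_atoms_neq0 sf)|].
move=> S1 S2 h1 h2 E; have [->|/eqP n1] := eqVneq S1 0; first by left.
right; have [A hA [T E1]] := pm_atoms_dvd sf h1 n1.
have AS : A = S by apply: (pm_atoms_anti sf) => //; exists (T + S2); rewrite E E1 addrA.
move: E; rewrite E1 AS -addrA -{1}[S]addr0 => /mset_addIr/esym/mset_add_eq0.
by case.
Qed.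

(** * Transfer homomorphisms to the monoid of zero-sum sequences *)

Section Transfer.
Variables (Q : choiceType) (G : zmodType) (c : Q -> G) (GP : set G).

(** Here [c] assigns classes to primes, and the image of [psi] consists of the divisors with class
    sum 0. The instances are the divisor theory of H, the inclusion of B(G_P) with [c] the identity,
    and the maps these induce on reduced monoids. The transfer homomorphism is [psi] followed by
    [mset_map c]. *)
Record transfer_map (M : nmodType) (psi : M -> {mset Q}) : Prop := TransferMap {
  tm0 : psi 0 = 0;
  tmD : forall a b, psi (a + b) = psi a + psi b;
  tm_img : forall D, zero_sum GP (mset_map c D) <-> exists a, psi a = D;
  tm_div : forall a b, mdvd (psi a) (psi b) -> mdvd a b }.

Section Monoid.
Variables (M : nmodType) (psi : M -> {mset Q}).
Hypothesis tm : transfer_map psi.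
Local Notation beta a := (mset_map c (psi a)).
Implicit Types a b u : M.

Lemma transfer_sum I (s : seq I) (p : pred I) (F : I -> M) :
  psi (\sum_(i <- s | p i) F i) = \sum_(i <- s | p i) psi (F i).
Proof. by apply: (big_morph psi) => [a b|]; rewrite ?(tmD tm) ?(tm0 tm). Qed.

Lemma transfer_zero_sum a : zero_sum GP (beta a).
Proof. by apply/(tm_img tm); exists a. Qed.

Lemma transfer_unit a : munit a <-> psi a = 0.
Proof.
split=> [[b ab0]|a0].
  by have := tm0 tm; rewrite -ab0 (tmD tm) => /mset_add_eq0[].
have [|b E] := @tm_div _ _ tm a 0; last by exists b.
by rewrite a0; exists (psi 0); rewrite add0r.
Qed.

Lemma transfer_assoc a b : psi a = psi b -> exists2 u, munit u & b = a + u.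
Proof.
move=> E; have [|u Eu] := @tm_div _ _ tm a b; first by rewrite E; exists 0; rewrite addr0.
exists u => //; apply/transfer_unit; apply: (@mset_addIr _ (psi a)).
by rewrite -(tmD tm) -Eu addr0.
Qed.

(** Split the divisor of [a] over S and T. The first part has class sum 0, so it is the image of
    some [a1], which divides [a] because [psi] reflects divisibility. *)
Lemma transfer_split a S T : zero_sum GP S -> beta a = S + T ->
  exists a1 a2, [/\ a = a1 + a2, beta a1 = S & beta a2 = T].
Proof.
move=> hS /mset_map_split[D1 [D2 [E E1 E2]]].
have [a1 ea1] : exists a1, psi a1 = D1 by apply/(tm_img tm); rewrite E1.
have [|a2 ea2] := @tm_div _ _ tm a1 a; first by rewrite E ea1; exists D2.
exists a1, a2; split; rewrite ?ea1 //.
suff -> : psi a2 = D2 by [].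
by apply: (@mset_addIr _ D1); rewrite -ea1 -(tmD tm) -ea2 E ea1.
Qed.

Lemma transfer_atom u : matom u <-> min_zero_sum GP (beta u).
Proof.
split=> [[nu hu]|[_ nu hu]].
  split; [exact: transfer_zero_sum|by move=> /mset_map_eq0/transfer_unit|].
  move=> S T hS hT /(transfer_split hS)[a1 [a2 [E <- <-]]].
  by have [/transfer_unit ->|/transfer_unit ->] := hu _ _ E;
    rewrite mset_map0; [left|right].
split=> [/transfer_unit u0|a b E]; first by apply: nu; rewrite u0 mset_map0.
have E' : beta u = beta a + beta b by rewrite E (tmD tm) mset_mapD.
by have [/mset_map_eq0/transfer_unit|/mset_map_eq0/transfer_unit] :=
  hu _ _ (transfer_zero_sum a) (transfer_zero_sum b) E'; [left|right].
Qed.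

Lemma transfer_lift a (s : seq {mset G}) :
  (forall A, A \in s -> zero_sum GP A) -> beta a = \sum_(A <- s) A ->
  exists (t : seq M) u,
    [/\ munit u, [seq beta x | x <- t] = s & a = \sum_(x <- t) x + u].
Proof.
elim: s a => [|A s IH] a hs.
  rewrite big_nil => /mset_map_eq0/transfer_unit ua.
  by exists [::], a; rewrite big_nil add0r.
rewrite big_cons => /transfer_split[|a1 [a2 [-> <- E]]].
  by apply: hs; rewrite mem_head.
have [B Bs|t [u [hu <- ->]]] := IH a2 _ E.
  by apply: hs; rewrite in_cons Bs orbT.
by exists (a1 :: t), u; rewrite big_cons addrA.
Qed.

(* The unit left over by [transfer_lift] is absorbed by the first element. *)
Lemma transfer_lift_atoms a (s : seq {mset G}) : s <> [::] ->
  (forall A, A \in s -> min_zero_sum GP A) -> beta a = \sum_(A <- s) A ->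
  exists t : seq M, [/\ forall x, x \in t -> matom x,
    [seq beta x | x <- t] = s & a = \sum_(x <- t) x].
Proof.
move=> s0 hs /transfer_lift[A /hs[] //|[|x t] [u [/transfer_unit hu es ->]]].
  by case: s0; rewrite -es.
have bE : beta (x + u) = beta x by rewrite (tmD tm) hu addr0.
exists ((x + u) :: t); split.
- move=> y yt; apply/transfer_atom; apply: hs; rewrite -es.
  move: yt; rewrite !in_cons => /orP[/eqP ->|yt]; first by rewrite bE eqxx.
  by rewrite (map_f (fun x => beta x) yt) orbT.
- by rewrite /= bE.
- by rewrite !big_cons addrAC.
Qed.

End Monoid.

Section Reduced.
Variables (M : nmodType) (psi : M -> {mset Q}).
Hypotheses (tm : transfer_map psi) (psi_inj : injective psi).
Local Notation beta a := (mset_map c (psi a)).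

(** Injectivity of [psi] leaves no unit over, so that this lift also covers the empty
    factorization. *)
Lemma transfer_lift_mset a (z : {mset {mset G}}) :
  Fab (zero_sum GP) z -> beta a = \sum_(A <- z) A ->
  exists2 w : {mset M}, mset_map (fun x => beta x) w = z & \sum_(x <- w) x = a.
Proof.
elim/mset_ind: z a => [|A z IH] a.
  move=> _; rewrite big_mset_zero => /mset_map_eq0 a0.
  exists 0; rewrite ?mset_map0 // big_mset_zero; apply: psi_inj.
  by rewrite a0 (tm0 tm).
move=> /FabD[/Fab1 hA hz]; rewrite big_mset_add big_mset_single.
move=> /(transfer_split tm hA)[a1 [a2 [-> <- E]]].
have [w <- <-] := IH a2 hz E; exists ([mset a1] + w).
  by rewrite mset_mapD mset_map1.
by rewrite big_mset_add big_mset_single.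
Qed.

Lemma transfer_sum_mset (w : {mset M}) :
  beta (\sum_(x <- w) x) = \sum_(A <- mset_map (fun x => beta x) w) A.
Proof. by rewrite big_mset_map (transfer_sum tm) mset_map_sum. Qed.

End Reduced.

Section Factorizations.
Variables (M : nmodType) (psi : M -> {mset Q}).
Hypothesis tm : transfer_map psi.
Local Notation beta a := (mset_map c (psi a)).

(** The representative does not matter, since [psi] sends units to 0; this is [red_mapE]. *)
Definition red_map (x : mred M) : {mset Q} := psi (repr x).

Lemma mred_classD (a b : M) : mred_class (a + b) = mred_class a + mred_class b.
Proof. exact: pi_mredD. Qed.

Lemma mred_class_repr (x : mred M) : mred_class (repr x) = x.
Proof. exact: reprK. Qed.

Lemma mred_class0 : mred_class (0 : M) = 0.
Proof. by rewrite /mred_class -[RHS]/(mred0 M) piE. Qed.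

Lemma mred_classP (a b : M) : mred_class a = mred_class b <-> massoc a b.
Proof. by split=> [/eqmodP|h]; last exact/eqmodP. Qed.

Lemma red_mapE a : red_map (mred_class a) = psi a.
Proof.
have /mred_classP/asboolP[u /(transfer_unit tm) hu E] :=
  esym (mred_class_repr (mred_class a)).
by rewrite /red_map E (tmD tm) hu addr0.
Qed.

Lemma red_map_inj : injective red_map.
Proof.
move=> x y E; rewrite -(mred_class_repr x) -(mred_class_repr y).
by apply/mred_classP/asboolP; exact: (transfer_assoc tm).
Qed.

Lemma red_map_transfer : transfer_map red_map.
Proof.
split.
- by rewrite -mred_class0 red_mapE (tm0 tm).
- move=> x y; rewrite -(mred_class_repr x) -(mred_class_repr y) -mred_classD.
  by rewrite !red_mapE (tmD tm).
- move=> D; rewrite (tm_img tm); split=> -[a <-].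
    by exists (mred_class a); rewrite red_mapE.
  by exists (repr a).
- move=> x y /(tm_div tm)[z E]; exists (mred_class z).
  by rewrite -(mred_class_repr y) E mred_classD mred_class_repr.
Qed.

Local Notation rbeta := (fun x : mred M => mset_map c (red_map x)).

Lemma factorizationsP a (z : {mset (mred M)}) : factorizations a z <->
  Fab (min_zero_sum GP) (mset_map rbeta z) /\ fact_value z = mred_class a.
Proof.
rewrite Fab_map; split=> -[h1 h2]; split=> // x /h1.
  exact: (transfer_atom red_map_transfer x).1.
exact: (transfer_atom red_map_transfer x).2.
Qed.

Lemma factorizations_shape a (z : {mset (mred M)}) : factorizations a z ->
  mset_facts (min_zero_sum GP) (beta a) (mset_map rbeta z).
Proof.
move=> /factorizationsP[h1 h2]; split=> //.
by rewrite -(transfer_sum_mset red_map_transfer) -red_mapE -h2.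
Qed.

Lemma factorizations_lift a w : mset_facts (min_zero_sum GP) (beta a) w ->
  exists2 z, factorizations a z & mset_map rbeta z = w.
Proof.
move=> [Fw Ew].
have Fw' : Fab (zero_sum GP) w by move=> A /Fw[].
have [|z hz1 hz2] := transfer_lift_mset red_map_transfer red_map_inj (a := mred_class a) Fw'.
  by rewrite red_mapE Ew.
by exists z => //; apply/factorizationsP; rewrite hz1.
Qed.

Lemma lengths_transfer a : lengths a = mset_lengths (min_zero_sum GP) (beta a).
Proof.
apply/seteqP; split=> n [z].
  by move=> /factorizations_shape h <-; exists (mset_map rbeta z); rewrite ?mlength_map.
by move=> /factorizations_lift[w hw <-] <-; exists w; rewrite ?mlength_map.
Qed.

End Factorizations.
End Transfer.

(** * The two instances: B(G_P) and the Krull monoid *)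

Section ZeroSumMonoid.
Variables (G : zmodType) (GP : set G).
Local Notation B := (zero_sum_monoid GP).

Lemma zero_sum_monoid_transfer : transfer_map id GP (val : B -> {mset G}).
Proof.
split=> // [D|a b [D E]].
  rewrite mset_map_id; split=> [hD|[a <-]]; last exact/asboolP/(valP a).
  have pD : zero_sum_pred GP D by apply/asboolP.
  by exists (ZeroSum pD).
have hD : zero_sum_pred GP D.
  apply/asboolP; apply: (@zero_sum_sub _ _ (val a)); first exact/asboolP/(valP a).
  by rewrite -E; exact/asboolP/(valP b).
by exists (ZeroSum hD); apply: val_inj.
Qed.

Lemma zero_sum_atomsE : zero_sum_atoms GP = min_zero_sum GP.
Proof.
apply/seteqP; split=> S.
  by move=> [u /(transfer_atom zero_sum_monoid_transfer) h <-]; rewrite mset_map_id in h.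
move=> hS; have pS : zero_sum_pred GP S by apply/asboolP; case: hS.
exists (ZeroSum pS) => //; apply/(transfer_atom zero_sum_monoid_transfer).
by rewrite mset_map_id.
Qed.

Lemma zero_sum_factorizationsE S : zero_sum GP S ->
  zero_sum_factorizations GP S = mset_facts (min_zero_sum GP) S.
Proof.
move=> hS; have mapE (z : {mset (mred B)}) :
    mset_map (fun x : mred B => val (repr x)) z =
    mset_map (fun x => mset_map id (red_map val x)) z.
  by apply: eq_mset_map => x; rewrite mset_map_id.
apply/seteqP; split=> w.
  move=> [b <- [z /(factorizations_shape zero_sum_monoid_transfer) hz ->]].
  by rewrite mapE; rewrite mset_map_id in hz.
have pS : zero_sum_pred GP S by apply/asboolP.
pose b := ZeroSum pS; move=> hw; exists b => //.
have [|z hz <-] := @factorizations_lift _ _ _ _ _ _ zero_sum_monoid_transfer b w.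
  by rewrite mset_map_id.
by exists z.
Qed.

Lemma zero_sum_lengthsE S : zero_sum GP S ->
  zero_sum_lengths GP S = mset_lengths (min_zero_sum GP) S.
Proof.
move=> hS; have pS : zero_sum_pred GP S by apply/asboolP.
apply/seteqP; split=> n.
  by move=> [b <-]; rewrite (lengths_transfer zero_sum_monoid_transfer) mset_map_id.
move=> hn; exists (ZeroSum pS) => //.
by rewrite (lengths_transfer zero_sum_monoid_transfer) mset_map_id.
Qed.

End ZeroSumMonoid.

Section KrullTransfer.
Local Open Scope quotient_scope.
Variables (H : nmodType) (P : choiceType) (phi : {additive H -> {mset P}}).
Hypothesis phi_div : divisor_theory phi.

Lemma qemb_inj : injective (@qemb {mset P}).
Proof.
move=> A B /eqmodP/asboolP[C] /=; rewrite !addr0.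
by rewrite [A + C]addrC [B + C]addrC => /mset_addIr.
Qed.

Definition quot_class (x : qgroup {mset P}) : class_group phi :=
  \pi_(Quotient.quot (qimage phi)) x.

Lemma quot_class0 : quot_class 0 = 0.
Proof. exact: lock. Qed.

Lemma quot_classD x y : quot_class (x + y) = quot_class x + quot_class y.
Proof. exact: Quotient.pi_add. Qed.

Lemma quot_class_eq0 x : quot_class x = 0 <-> x \in qimage phi.
Proof.
rewrite -quot_class0 -[x in x \in _]subr0 Quotient.idealrBE.
by split=> /eqP.
Qed.

Lemma sigma_prime_class (D : {mset P}) :
  sigma (mset_map (prime_class phi) D) = quot_class (qemb D).
Proof.
rewrite /sigma big_mset_map; elim/mset_ind: D => [|p D IH].
  by rewrite big_mset_zero raddf0 quot_class0.
by rewrite big_mset_add big_mset_single IH raddfD quot_classD.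
Qed.

Lemma krull_transfer : transfer_map (prime_class phi) (prime_classes phi) phi.
Proof.
split; [exact: raddf0|exact: raddfD| |exact: phi_div.1].
move=> D; split=> [[_ /=]|[a <-]].
  (* If the class of D is 0, then D is the quotient of [phi a] by [phi b]. So [phi b] divides
     [phi a], hence [b] divides [a], and the cofactor is mapped to D. *)
  rewrite sigma_prime_class => /quot_class_eq0/asboolP[a [b /eqP]].
  rewrite -subr_eq opprK addrC -raddfD => /eqP/qemb_inj E.
  have [c Ec] : mdvd b a by apply: phi_div.1; rewrite -E; exists D.
  exists c; apply: (@mset_addIr _ (phi b)).
  by rewrite -raddfD -Ec E.
split; first by apply/Fab_map => p _; exists p.
rewrite /= sigma_prime_class; apply/quot_class_eq0/asboolP.
by exists a, 0; rewrite !raddf0 addr0.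
Qed.

End KrullTransfer.

(** * Invariants of the system of sets of lengths *)

Section Extrema.
Variable R : realType.
Implicit Types A : set nat.

Lemma nat_sup_max A n : A n -> (forall m, A m -> (m <= n)%N) -> nat_sup R A = (n%:R)%:E.
Proof.
move=> An h; apply/eqP; rewrite eq_le; apply/andP; split.
  by apply: ge_ereal_sup => _ [m /h hm <-]; rewrite lee_fin ler_nat.
by apply: ereal_sup_ubound; exists n.
Qed.

Lemma nat_inf_min A n : A n -> (forall m, A m -> (n <= m)%N) -> nat_inf R A = (n%:R)%:E.
Proof.
move=> An h; apply/eqP; rewrite eq_le; apply/andP; split.
  by apply: ereal_inf_lbound; exists n.
by apply: le_ereal_inf_tmp => _ [m /h hm <-]; rewrite lee_fin ler_nat.
Qed.

Lemma nat_inf_le A n : A n -> (nat_inf R A <= (n%:R)%:E)%E.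
Proof. by move=> An; apply: ereal_inf_lbound; exists n. Qed.

Lemma ereal_sup_max (X : set (\bar R)) x : X x -> (forall y, X y -> (y <= x)%E) ->
  ereal_sup X = x.
Proof.
move=> Xx h; apply/eqP; rewrite eq_le ereal_sup_ubound // andbT.
exact: ge_ereal_sup.
Qed.

End Extrema.

Section LengthSystem.
Variables (R : realType) (H : nmodType) (d : nat).
Hypothesis d_gt0 : (0 < d)%N.
Hypothesis systemE :
  length_system H = [set L | exists m k, L = length_AP d m k].

Lemma length_APP m k n :
  length_AP d m k n <-> exists2 i, (i <= k)%N & n = (m + (2 * k + d * i))%N.
Proof. by split=> [[i]|[i]]; exists i. Qed.

Lemma distance_setE : distance_set H = [set d].
Proof.
apply/seteqP; split=> x.
  move=> [L]; rewrite systemE => -[m [k ->]] [x0 [n]].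
  move=> [/length_APP[i hi ->] /length_APP[j hj E] hn].
  have ij : (d * i < d * j)%N by lia.
  rewrite ltn_pmul2l // in ij.
  have [ej|ne] := eqVneq i.+1 j; first by move: E; rewrite -ej mulnS /=; lia.
  have ij2 : (d * i.+1 < d * j)%N by rewrite ltn_pmul2l // ltn_neqAle ne.
  case: (hn (m + (2 * k + d * i.+1))%N).
    by apply/length_APP; exists i.+1 => //; lia.
  by move: ij2; rewrite mulnS; lia.
(* The set {2, d + 2}, which also attains the elasticity below. *)
move=> ->; exists (length_AP d 0 1); first by rewrite systemE; exists 0%N, 1%N.
split=> //; exists 2; split.
- by apply/length_APP; exists 0%N => //; lia.
- by apply/length_APP; exists 1%N => //; lia.
- move=> m /length_APP[[|[|i]] // _ ->]; lia.
Qed.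

(** A progression with parameter p has at most p steps and minimum at least 2p. Going up j steps
    from k therefore needs 2j <= k, and going down j steps needs (d + 2)j <= k; both are realized by
    progressions with p = j that begin, respectively end, at k. *)
Lemma unionsP k n : unions_of_lengths H k n <->
  (exists2 j, (2 * j <= k)%N & n = (k + d * j)%N) \/
  (exists2 j, ((d + 2) * j <= k)%N & k = (n + d * j)%N).
Proof.
rewrite /unions_of_lengths; split=> [[L [/= Ls Lk] Ln]|].
  move: Ls Lk Ln; rewrite systemE => -[m [p ->]] /length_APP[i hi Ei] /length_APP[j hj Ej].
  have [ij|ji] := leqP i j.
    by left; exists (j - i)%N; rewrite ?mulnBr; have := leq_mul (leqnn d) ij; lia.
  right; exists (i - j)%N; have := leq_mul (leqnn d) (ltnW ji); last by rewrite mulnBr; lia.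
  by rewrite mulnDl mulnBr; lia.
case=> -[j hj E].
  exists (length_AP d (k - 2 * j) j); first split.
  - by rewrite systemE; exists (k - 2 * j)%N, j.
  - by apply/length_APP; exists 0%N => //; lia.
  - by apply/length_APP; exists j => //; lia.
move: hj; rewrite mulnDl => hj; exists (length_AP d (k - (d + 2) * j) j); first split.
- by rewrite systemE; exists (k - (d + 2) * j)%N, j.
- by apply/length_APP; exists j => //; rewrite mulnDl; lia.
- by apply/length_APP; exists 0%N => //; rewrite mulnDl; lia.
Qed.

Lemma unions_AP k : is_AP d (unions_of_lengths H k).
Proof.
(* The largest numbers of steps down and up that [unionsP] allows. *)
pose a := (k %/ (d + 2))%N; pose b := (k %/ 2)%N.
have ha : (d * a + 2 * a <= k)%N.
  by have := leq_trunc_div k (d + 2); rewrite -/a mulnDr mulnC [(a * 2)%N]mulnC.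
exists (k - d * a)%N, (a + b)%N; apply/seteqP; split=> n.
  case/unionsP=> -[j hj E].
    have jb : (j <= b)%N by rewrite leq_divRL // mulnC.
    by exists (a + j)%N => /=; rewrite ?leq_add2l ?mulnDr; lia.
  have ja : (j <= a)%N by rewrite leq_divRL ?addn2 // mulnC -addn2.
  exists (a - j)%N => /=; first by lia.
  by rewrite mulnBr; have := leq_mul (leqnn d) ja; lia.
move=> [i /= hi <-]; apply/unionsP; have [ia|ai] := leqP a i.
  left; exists (i - a)%N; last by rewrite mulnBr; have := leq_mul (leqnn d) ia; lia.
  have : (b * 2 <= k)%N by apply: leq_trunc_div.
  by lia.
right; exists (a - i)%N; last by rewrite mulnBr; have := leq_mul (leqnn d) (ltnW ai); lia.
by rewrite mulnDl mulnBr; lia.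
Qed.

Lemma rhoE k j : (j <= 1)%N -> rho_ R H (2 * k + j) = ((k * (d + 2) + j)%:R)%:E.
Proof.
move=> j1; apply: nat_sup_max.
  by apply/unionsP; left; exists k; rewrite ?mulnDr; lia.
move=> n /unionsP[[i hi ->]|[i hi E]].
  have ik : (i <= k)%N by lia.
  by have := leq_mul (leqnn d) ik; rewrite mulnDr; lia.
by rewrite mulnDr; lia.
Qed.

Lemma lambdaE l j : (j < d + 2)%N ->
  lambda_ R H (l * (d + 2) + j) = ((2 * l + j)%:R)%:E.
Proof.
move=> hj; apply: nat_inf_min.
  by apply/unionsP; right; exists l; rewrite ?mulnDr ?mulnDl; lia.
move=> n /unionsP[[i hi ->]|[i hi E]]; first by rewrite mulnDr; lia.
have il : (i <= l)%N.
  rewrite -ltnS -(ltn_pmul2l (_ : 0 < d + 2)%N) ?addn2 // -addn2.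
  by apply: leq_ltn_trans hi _; rewrite mulnS [(l * _)%N]mulnC; lia.
by have := leq_mul (leqnn d) il; move: E; rewrite mulnDr; lia.
Qed.

Lemma elasticityE : elasticity R H = ((d + 2)%:R / 2)%:E.
Proof.
have supE m k : nat_sup R (length_AP d m k) = ((m + (d + 2) * k)%:R)%:E.
  apply: nat_sup_max; first by apply/length_APP; exists k; rewrite ?mulnDl; lia.
  by move=> n /length_APP[i hi ->]; have := leq_mul (leqnn d) hi; rewrite mulnDl; lia.
have infE m k : nat_inf R (length_AP d m k) = ((m + 2 * k)%:R)%:E.
  apply: nat_inf_min; first by apply/length_APP; exists 0%N; rewrite ?muln0; lia.
  by move=> n /length_APP[i hi ->]; lia.
apply: ereal_sup_max.
  exists (length_AP d 0 1).
    split; first by rewrite systemE; exists 0%N, 1%N.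
    move=> E; have : [set 0%N] 2; last by [].
    by rewrite -E; apply/length_APP; exists 0%N => //; lia.
  by rewrite supE infE inver pnatr_eq0 /= muln1 add0n -EFinM.
move=> _ [L [/= Ls L0] <-]; move: Ls L0; rewrite systemE => -[m [k ->]] L0.
rewrite supE infE.
(* The excluded set {0} is the case m = k = 0, in which the denominator would vanish. *)
have mk : (0 < m + 2 * k)%N.
  rewrite lt0n; apply/eqP => mk; apply: L0.
  have [-> ->] : m = 0%N /\ k = 0%N by lia.
  apply/seteqP; split=> n /=; first by move=> /length_APP[i]; lia.
  by move=> ->; apply/length_APP; exists 0%N => //; lia.
rewrite inver pnatr_eq0 (gtn_eqF mk).
rewrite -EFinM lee_fin ler_pdivrMr ?ltr0n // mulrAC ler_pdivlMr ?ltr0n //.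
by rewrite -!natrM ler_nat; nia.
Qed.

End LengthSystem.

(** * Catenary degree and monotone catenary degree *)

Section Chains.
Variables (K : choiceType) (n : nat).
Implicit Types (X : set {mset K}) (z w : {mset K}).

(** Only nondecreasing chains are constructed; as [fdist] is symmetric, [mon_chain_rev_seq] turns
    them into nonincreasing ones. *)
Inductive mon_chain X : {mset K} -> {mset K} -> Prop :=
| MonChain0 z : X z -> mon_chain X z z
| MonChainS z w z' : X z -> (fdist z w <= n)%N -> (mlength z <= mlength w)%N ->
    mon_chain X w z' -> mon_chain X z z'.

Lemma mon_chain_end X z z' : mon_chain X z z' -> X z'.
Proof. by elim. Qed.

Lemma mon_chain_trans X z w z' : mon_chain X z w -> mon_chain X w z' -> mon_chain X z z'.
Proof. by elim=> // y y' y'' Xy h1 h2 _ IH /IH; exact: MonChainS. Qed.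

Lemma mon_chain_addl X Y w z z' : (forall y, X y -> Y (w + y)) ->
  mon_chain X z z' -> mon_chain Y (w + z) (w + z').
Proof.
move=> h; elim=> [y Xy|y y' y'' Xy h1 h2 _ IH]; first by apply: MonChain0; exact: h.
apply: MonChainS IH; rewrite ?fdist_addl ?mlengthD ?leq_add2l //; exact: h.
Qed.

Lemma mon_chain_seq X z z' : mon_chain X z z' -> exists s : seq {mset K},
  [/\ forall y, y \in z :: s -> X y,
      path (fun x y => fdist x y <= n)%N z s, last z s = z' &
      sorted leq (map (@mlength _) (z :: s))].
Proof.
elim=> [y Xy|y y' y'' Xy h1 h2 _ [s [s1 s2 s3 s4]]].
  by exists [::]; split=> // x; rewrite mem_seq1 => /eqP ->.
exists (y' :: s); split=> //=; last 2 first.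
- by rewrite h1 s2.
- by rewrite h2.
- by move=> x; rewrite in_cons => /orP[/eqP -> //|/s1].
Qed.

Lemma mon_chain_rev_seq X z z' : mon_chain X z z' -> exists s : seq {mset K},
  [/\ forall y, y \in z' :: s -> X y,
      path (fun x y => fdist x y <= n)%N z' s, last z' s = z &
      sorted geq (map (@mlength _) (z' :: s))].
Proof.
move=> /mon_chain_seq[s [s1 s2 <- s4]].
have revE : last z s :: rev (belast z s) = rev (z :: s).
  by rewrite [in RHS]lastI rev_rcons.
exists (rev (belast z s)); split.
- by move=> y; rewrite revE mem_rev => /s1.
- by rewrite rev_path; under eq_path do rewrite fdistC.
- by case: s {s1 s2 s4 revE} => //= y s; rewrite rev_cons last_rcons.
- by rewrite revE map_rev rev_sorted.
Qed.

End Chains.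

Section Catenary.
Variables (Q : choiceType) (G : zmodType) (c : Q -> G).
Variables (r alpha : nat) (e : 'I_r.+1 -> G).
Hypothesis sf : special_family alpha e.

Let r_gt0 : (0 < r)%N. Proof. by case: sf. Qed.
Let alpha_gt0 : (0 < alpha)%N. Proof. by case: sf. Qed.
Let r_alpha : (2 < r + alpha)%N. Proof. by case: sf. Qed.

Local Notation GP := (pm_classes e).
Local Notation V := (seqV alpha e).
Local Notation W := (mset_opp (seqV alpha e)).
Local Notation U := (seqU e).
Local Notation At := (pm_atoms alpha e).
Local Notation lf := (lift ord0).
Local Notation D := (r + alpha)%N.

(** The shorter factorization has strictly more V, and by [zfact_shift] strictly more -V. It
    therefore contains a pair that can be broken, and doing so does not overshoot the longer
    length. *)
Lemma mset_facts_lt_length S z z' : mset_facts At S z -> mset_facts At S z' ->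
  (mlength z < mlength z')%N ->
  [/\ (0 < z V)%N, (0 < z W)%N & (mlength z + (D - 2) <= mlength z')%N].
Proof.
move=> h h' lt; have E := zfact_length_V sf h h'; have E' := zfact_shift sf h h'.
have lt' : ((r + alpha - 2) * z' V < (r + alpha - 2) * z V)%N by lia.
have ltV : (z' V < z V)%N by move: lt'; rewrite ltn_mul2l => /andP[].
split; [by lia..|].
by have := leq_mul (leqnn (r + alpha - 2)) ltV; rewrite mulnS; lia.
Qed.

Definition splitVW : {mset {mset G}} :=
  zform alpha e 0 0 (fun i => if i == ord0 then alpha else 1%N).

Lemma splitVW_facts : mset_facts At (V + W) splitVW.
Proof.
apply: (zform_zfact sf).
  by apply/FabD; split; [exact: Fab_seqV|exact: Fab_seqW].
by split=> [||t|t]; rewrite mset_addE !(atE sf) /=; lia.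
Qed.

Lemma mlength_splitVW : mlength splitVW = D.
Proof.
rewrite mlength_zform big_ord_recl /=.
by rewrite sum_nat_const card_ord muln1; lia.
Qed.

Lemma pairVW_facts : mset_facts At (V + W) ([mset V] + [mset W]).
Proof. by apply: zfactD; apply: zfact1; [exact: pm_atomsV|exact: pm_atomsW]. Qed.

Section ReducedMonoid.
Variables (N : nmodType) (rho : N -> {mset Q}).
Hypotheses (tm : transfer_map c GP rho) (rho_inj : injective rho).
Local Notation rb := (fun x : N => mset_map c (rho x)).
Implicit Types (a x y : N) (z w : {mset N}).

(** For a reduced monoid N, where factorizations of [a] have [a] itself as their product. *)
Definition atom_facts a : set {mset N} :=
  [set z | Fab At (mset_map rb z) /\ \sum_(x <- z) x = a].

Lemma atom_facts_shape a z : atom_facts a z -> mset_facts At (rb a) (mset_map rb z).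
Proof.
by move=> [h1 <-]; split; rewrite // (transfer_sum_mset tm).
Qed.

Lemma atom_factsD a b z w : atom_facts a z -> atom_facts b w -> atom_facts (a + b) (z + w).
Proof.
move=> [h1 h2] [g1 g2]; split; first by rewrite mset_mapD; apply/FabD.
by rewrite big_mset_add h2 g2.
Qed.

Lemma rho_addI a b x : x + a = x + b -> a = b.
Proof.
move=> E; apply: rho_inj; apply: (@mset_addIr _ (rho x)).
by rewrite -!(tmD tm) E.
Qed.

Lemma atom_swap x x' z : At (rb x) -> rb x = rb x' -> Fab At (mset_map rb z) ->
  mdvd (rho x') (rho x + rho (\sum_(y <- z) y)) ->
  exists2 z1, mset_map rb z1 = mset_map rb z &
    mon_chain D (atom_facts (x + \sum_(y <- z) y)) ([mset x] + z) ([mset x'] + z1).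
Proof.
move: {2}(mlength (rho x' `\` rho x)%mset) (erefl (mlength (rho x' `\` rho x)%mset)) => k.
elim: k x z => [|k IH] x z Ek hx Ex Fz dv.
  have le : mdvd (rho x') (rho x).
    apply/mset_dvdP => q; move/mlength_eq0/msetP/(_ q): Ek.
    by rewrite msetE2 mset_zeroE; lia.
  have /rho_inj <- : rho x' = rho x.
    by apply: mset_dvd_length_eq le _; rewrite -!(mlength_map c) Ex.
  exists z => //; apply: MonChain0; split.
    by rewrite mset_mapD mset_map1; apply/FabD; split=> //; apply/Fab1; rewrite -Ex.
  by rewrite big_mset_add big_mset_single.
have [q hq] : exists q, (rho x q < rho x' q)%N.
  have [|q] := @mset_neq0P _ (rho x' `\` rho x)%mset.
    by apply/eqP => /(congr1 (@mlength Q)); rewrite [LHS]Ek mlength0.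
  by rewrite in_msetB => hq; exists q.
(* After removal of their gcd, the divisors of [x] and [x'] still have the same classes, so the
   class of [q] occurs on the side of [x]. *)
have [p hp cpq] : exists2 p, (rho x' p < rho x p)%N & c p = c q.
  have EA : rho x = (rho x `&` rho x')%mset + (rho x `\` rho x')%mset.
    by apply/msetP => t; rewrite mset_addE !msetE2; lia.
  have EA' : rho x' = (rho x `&` rho x')%mset + (rho x' `\` rho x)%mset.
    by apply/msetP => t; rewrite mset_addE !msetE2; lia.
  have cA : mset_map c (rho x `\` rho x')%mset = mset_map c (rho x' `\` rho x)%mset.
    apply: (@mset_addIr _ (mset_map c (rho x `&` rho x')%mset)).
    by rewrite -!mset_mapD -EA -EA'.
  have /mem_mset_map[p] : c q \in mset_map c (rho x `\` rho x')%mset.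
    have /mset_pick[T ET] : q \in (rho x' `\` rho x)%mset by rewrite in_msetB.
    by rewrite cA ET mset_mapD mset_map1 mem_mset_add mem_mset_single eqxx.
  by rewrite in_msetB => hp cpq; exists p.
have pq : (p == q) = false by apply/eqP => E; move: hp hq; rewrite E; lia.
have [B EB] : exists B, rho x = [mset p] + B.
  by apply: mset_pick; rewrite in_mset; lia.
have [y yz qy] : exists2 y, y \in z & q \in rho y.
  apply: mem_big_mset; rewrite -(transfer_sum tm) in_mset.
  by have := (mset_dvdP _ _).1 dv q; rewrite mset_addE; lia.
have [C EC] := mset_pick qy; have [z0 Ez] := mset_pick yz.
have [x1 Ex1] : exists x1, rho x1 = [mset q] + B.
  apply/(tm_img tm); rewrite mset_mapD mset_map1 -cpq -mset_map1 -mset_mapD -EB.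
  exact: transfer_zero_sum.
have [y1 Ey1] : exists y1, rho y1 = [mset p] + C.
  apply/(tm_img tm); rewrite mset_mapD mset_map1 cpq -mset_map1 -mset_mapD -EC.
  exact: transfer_zero_sum.
have rx1 : rb x1 = rb x by rewrite Ex1 EB !mset_mapD !mset_map1 cpq.
have ry1 : rb y1 = rb y by rewrite Ey1 EC !mset_mapD !mset_map1 cpq.
have Exy : x1 + y1 = x + y.
  apply: rho_inj; rewrite !(tmD tm) Ex1 Ey1 EB EC.
  by rewrite addrACA [[mset q] + [mset p]]addrC addrACA.
have Esum : x1 + \sum_(t <- ([mset y1] + z0 : {mset N})) t = x + \sum_(t <- z) t.
  by rewrite Ez !big_mset_add !big_mset_single !addrA Exy.
have Eshape : mset_map rb ([mset y1] + z0) = mset_map rb z.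
  by rewrite Ez !mset_mapD !mset_map1 ry1.
(* The exchange lowers the number of missing primes by exactly one: [q] is gained, and [p] was in
   excess. *)
have hk1 : mlength (rho x' `\` rho x1)%mset = k.
  apply/eqP; rewrite -eqSS -Ek -add1n -(mlength1 q) -mlengthD; apply/eqP; congr mlength.
  apply/msetP => t; rewrite mset_addE !msetE2 Ex1 EB !mset_addE !mset_singleE.
  have := hp; have := hq; rewrite EB !mset_addE !mset_singleE eqxx [q == p]eq_sym pq.
  have [->|tq] := eqVneq t q; first by rewrite eq_sym pq; lia.
  by have [->|tp] := eqVneq t p; lia.
have hd1 : mdvd (rho x') (rho x1 + rho (\sum_(t <- ([mset y1] + z0 : {mset N})) t)).
  by rewrite -(tmD tm) Esum (tmD tm).
have [z1 hz1 ch] : exists2 z1, mset_map rb z1 = mset_map rb ([mset y1] + z0) &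
    mon_chain D (atom_facts (x1 + \sum_(t <- ([mset y1] + z0 : {mset N})) t))
      ([mset x1] + ([mset y1] + z0)) ([mset x'] + z1).
  by apply: IH => //; rewrite ?rx1 ?Eshape.
exists z1; first by rewrite hz1.
rewrite Esum in ch; apply: MonChainS ch.
- split; first by rewrite mset_mapD mset_map1; apply/FabD; split=> //; apply/Fab1.
  by rewrite big_mset_add big_mset_single.
- rewrite Ez !addrA [_ + z0]addrC [X in fdist _ X]addrC fdist_addl.
  by apply: leq_trans (fdist_le _ _) _; rewrite !mlengthD !mlength1; lia.
- by rewrite Ez !mlengthD !mlength1.
Qed.

(** One factor [x'] of [z'] is produced by [atom_swap] from a factor of the same shape; it is then
    common to both sides and can be cancelled. *)
Lemma same_shape_chain z z' : mset_map rb z = mset_map rb z' ->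
  Fab At (mset_map rb z) -> \sum_(x <- z) x = \sum_(x <- z') x ->
  mon_chain D (atom_facts (\sum_(x <- z) x)) z z'.
Proof.
elim/mset_ind: z' z => [|x' z1' IH] z Es Fz Esum.
  move: Es; rewrite mset_map0 => /mset_map_eq0 z0; rewrite z0.
  by apply: MonChain0; split; rewrite // mset_map0; exact: Fab0.
have /mem_mset_map[x /mset_pick[z0 Ez] Ex] : rb x' \in mset_map rb z.
  by rewrite Es mset_mapD mset_map1 mem_mset_add mem_mset_single eqxx.
have Es0 : mset_map rb z0 = mset_map rb z1'.
  move: Es; rewrite Ez !mset_mapD !mset_map1 Ex => h.
  exact: mset_addIr h.
have [Fx Fz0] : At (rb x) /\ Fab At (mset_map rb z0).
  by move: Fz; rewrite Ez mset_mapD mset_map1 => /FabD[/Fab1].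
have Ez' : \sum_(y <- z) y = x + \sum_(y <- z0) y.
  by rewrite Ez big_mset_add big_mset_single.
have Ez1' : \sum_(y <- ([mset x'] + z1' : {mset N})) y = x' + \sum_(y <- z1') y.
  by rewrite big_mset_add big_mset_single.
have [|z1 Es1 ch] := atom_swap Fx Ex Fz0.
  by rewrite -(tmD tm) -Ez' Esum Ez1' (tmD tm); exists (rho (\sum_(y <- z1') y)).
rewrite -Ez' -Ez in ch; apply: (mon_chain_trans ch).
have [_ Ez1] := mon_chain_end ch.
have Ez11 : \sum_(y <- z1) y = \sum_(y <- z1') y.
  apply: (@rho_addI _ _ x'); rewrite -Ez1' -Esum -Ez1.
  by rewrite big_mset_add big_mset_single.
have Fz1 : Fab At (mset_map rb z1) by rewrite Es1.
apply: mon_chain_addl (IH z1 _ Fz1 Ez11); last by rewrite Es1.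
move=> y hy; have : atom_facts x' [mset x'].
  by split; rewrite ?mset_map1 ?big_mset_single //; apply/Fab1; rewrite -Ex.
move=> /atom_factsD/(_ hy); rewrite Esum Ez1' Ez11.
by [].
Qed.

Lemma up_chain a z z' : atom_facts a z -> atom_facts a z' ->
  (mlength z <= mlength z')%N -> mon_chain D (atom_facts a) z z'.
Proof.
move=> hz hz'; move: {2}(mlength z' - mlength z)%N (leqnn (mlength z' - mlength z)%N) => k.
elim: k z hz => [|k IH] z hz hk le.
  have Es : mset_map rb z = mset_map rb z'.
    apply: (zfact_eq sf (atom_facts_shape hz) (atom_facts_shape hz')).
    by rewrite !mlength_map; lia.
  by have := same_shape_chain Es hz.1; rewrite hz.2 hz'.2; exact.
have [E|ne] := eqVneq (mlength z) (mlength z'); first by apply: IH => //; lia.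
have [|hV hW hd] := mset_facts_lt_length (atom_facts_shape hz) (atom_facts_shape hz').
  by rewrite !mlength_map; lia.
rewrite !mlength_map in hd.
have /mem_mset_map[x /mset_pick[z0 Ez] Ex] : V \in mset_map rb z by rewrite in_mset.
have /mem_mset_map[y /mset_pick[z1 Ez0] Ey] : W \in mset_map rb z0.
  rewrite in_mset; move: hW; rewrite Ez mset_mapD mset_map1 Ex mset_addE mset_singleE.
  by rewrite eq_sym (seqV_neqW sf).
have Fs : Fab (zero_sum GP) splitVW.
  by move=> A /splitVW_facts.1/(pm_atoms_zero_sum sf).
have [|w Ew1 Ew2] := transfer_lift_mset tm rho_inj (a := x + y) Fs.
  by rewrite (tmD tm) mset_mapD Ex Ey splitVW_facts.2.
have lw : mlength w = D by rewrite -(mlength_map rb) Ew1 mlength_splitVW.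
have lz : mlength z = (mlength z1).+2 by rewrite Ez Ez0 !mlengthD !mlength1.
have hw : atom_facts a (z1 + w).
  have [] := hz; rewrite Ez Ez0 !mset_mapD !mset_map1 !big_mset_add !big_mset_single.
  move=> /FabD[_ /FabD[_ Fz1]] Ea; split.
    by rewrite mset_mapD Ew1; apply/FabD; split=> //; exact: splitVW_facts.1.
  by rewrite big_mset_add Ew2 -Ea [RHS]addrA [RHS]addrC.
apply: (@MonChainS _ _ _ _ (z1 + w)) => //.
- rewrite Ez Ez0 addrA [_ + z1]addrC fdist_addl.
  by apply: leq_trans (fdist_le _ _) _; rewrite lw !mlengthD !mlength1; lia.
- by rewrite mlengthD lw lz; lia.
- by apply: IH => //; rewrite mlengthD lw; lia.
Qed.

(** Without their gcd, [y] and [y'] are factorizations of one element with the first still shorter.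
    The rest of [y] thus contains both V and -V, so it is all of [y] and the gcd is trivial. *)
Lemma fdist_splitVW a (y y' : {mset N}) : atom_facts a y -> atom_facts a y' ->
  mlength y = 2 -> mlength y' = D -> fdist y y' = D.
Proof.
move=> hy hy' ly ly'; set g := (y `&` y')%mset.
have Ey : y = g + (y `\` g)%mset.
  by apply/msetP => t; rewrite mset_addE !msetE2; lia.
have Ey' : y' = g + (y' `\` g)%mset.
  by apply/msetP => t; rewrite mset_addE !msetE2; lia.
have ll : mlength y = (mlength g + mlength (y `\` g)%mset)%N by rewrite -mlengthD -Ey.
have ll' : mlength y' = (mlength g + mlength (y' `\` g)%mset)%N by rewrite -mlengthD -Ey'.
have h : atom_facts (\sum_(x <- (y `\` g)%mset) x) (y `\` g)%mset.
  by split=> //; move: hy => -[]; rewrite {1}Ey mset_mapD => /FabD[].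
have h' : atom_facts (\sum_(x <- (y `\` g)%mset) x) (y' `\` g)%mset.
  split; first by move: hy' => -[]; rewrite {1}Ey' mset_mapD => /FabD[].
  apply: (@rho_addI _ _ (\sum_(x <- g) x)).
  by rewrite -!big_mset_add -Ey -Ey' hy.2 hy'.2.
have [|hV hW _] := mset_facts_lt_length (atom_facts_shape h) (atom_facts_shape h').
  by rewrite !mlength_map; lia.
have := zfact_length sf (atom_facts_shape h); rewrite mlength_map => l2.
by rewrite /fdist -/g; lia.
Qed.

End ReducedMonoid.

Section CatenaryDegree.
Variables (R : realType) (M : nmodType) (psi : M -> {mset Q}).
Hypothesis tm : transfer_map c GP psi.
Hypothesis c_surj : forall g, GP g -> exists q, c q = g.
Local Notation beta a := (mset_map c (psi a)).
Let tmr := red_map_transfer tm.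
Let rinj := red_map_inj tm.

Lemma factorizations_atom_facts (a : M) :
  factorizations a = atom_facts (red_map psi) (mred_class a).
Proof.
by apply/seteqP; split=> z;
  rewrite /atom_facts /= (factorizationsP tm) (min_zero_sum_pm sf).
Qed.

Lemma transfer_surj S : zero_sum GP S -> exists a, beta a = S.
Proof.
move=> hS; have [E hE] : exists E, mset_map c E = S.
  case: hS => FS _; elim/mset_ind: S FS => [_|g S IH].
    by exists 0; rewrite mset_map0.
  move=> /FabD[/Fab1/c_surj[q <-] /IH[E <-]]; exists ([mset q] + E).
  by rewrite mset_mapD mset_map1.
have [a Ea] : exists a, psi a = E by apply/(tm_img tm); rewrite hE.
by exists a; rewrite Ea.
Qed.

Lemma mon_catenary_bound_D (a : M) : mon_catenary_bound a D.
Proof.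
move=> z z'; rewrite factorizations_atom_facts => hz hz'.
have [le|/ltnW le] := leqP (mlength z) (mlength z').
  have [s [s1 s2 s3 s4]] := mon_chain_seq (up_chain tmr rinj hz hz' le).
  by exists s; split; [split=> //; rewrite factorizations_atom_facts|left].
have [s [s1 s2 s3 s4]] := mon_chain_rev_seq (up_chain tmr rinj hz' hz le).
by exists s; split; [split=> //; rewrite factorizations_atom_facts|right].
Qed.

Lemma mon_catenary_boundW (a : M) n : mon_catenary_bound a n -> catenary_bound a n.
Proof. by move=> h z z' hz hz'; have [s [hs _]] := h z z' hz hz'; exists s. Qed.

(** For [a] lying over V (-V), a chain from length 2 to length r + alpha must make the jump in a
    single step. *)
Lemma catenary_bound_ge : exists a : M, forall n, catenary_bound a n -> (D <= n)%N.
Proof.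
have [a Ea] := transfer_surj (zfact_zero_sum sf splitVW_facts).
exists a => n hn.
have lift w : mset_facts At (V + W) w ->
    exists2 z, factorizations a z & mlength z = mlength w.
  rewrite -Ea -(min_zero_sum_pm sf) => /(factorizations_lift tm)[z hz <-].
  by exists z; rewrite ?mlength_map.
have [z hz lz] := lift _ pairVW_facts; have [z' hz' lz'] := lift _ splitVW_facts.
rewrite mlengthD !mlength1 in lz; rewrite mlength_splitVW in lz'.
(* As e_1 occurs once in V (-V), the number of V is 0 or 1, and it determines the length. *)
have len y : factorizations a y -> mlength y = 2 \/ mlength y = D.
  move=> /(factorizations_shape tm); rewrite Ea (min_zero_sum_pm sf) => hy.
  have := zfact_length_V sf hy pairVW_facts; have := zfact_counts sf hy.
  case=> _ _ /(_ (Ordinal r_gt0)) h _; move: h; rewrite mset_addE !(atE sf) mlength_map.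
  rewrite mlengthD !mlength1 mset_addE !mset_singleE eqxx (seqV_neqW sf).
  case: (mset_map _ y V) => [|[|]] //; lia.
have [s [s1 s2 s3]] := hn z z' hz hz'.
elim: s z lz hz s1 s2 s3 {hz'} => [|y s IH] z lz hz s1 /=.
  by move=> _ E; move: lz; rewrite E lz'; lia.
move=> /andP[d1 d2] E; have hy : factorizations a y.
  by apply: s1; rewrite !inE eqxx orbT.
have [ly|ly] := len y hy.
  apply: (IH y) => // t ht; apply: s1; rewrite in_cons ht orbT //.
rewrite factorizations_atom_facts in hz hy.
by rewrite -(fdist_splitVW tmr rinj hz hy lz ly).
Qed.

Lemma catenary_degreeE : catenary_degree R M = (D%:R)%:E.
Proof.
have [a ha] := catenary_bound_ge.
apply: ereal_sup_max.
  exists a => //; apply: nat_inf_min => //.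
  exact/mon_catenary_boundW/mon_catenary_bound_D.
move=> _ [b _ <-]; apply: nat_inf_le.
exact/mon_catenary_boundW/mon_catenary_bound_D.
Qed.

Lemma mon_catenary_degreeE : mon_catenary_degree R M = (D%:R)%:E.
Proof.
have [a ha] := catenary_bound_ge.
apply: ereal_sup_max.
  exists a => //; apply: nat_inf_min; first exact: mon_catenary_bound_D.
  by move=> n /mon_catenary_boundW/ha.
by move=> _ [b _ <-]; apply: nat_inf_le; exact: mon_catenary_bound_D.
Qed.

End CatenaryDegree.
End Catenary.

(** * Omega invariant and tame degree *)

Section OppositeFamily.
Variables (G : zmodType) (r alpha : nat) (e : 'I_r.+1 -> G).

(** Reduces the case of -V to that of V, since -V is the sequence V of the negated family. *)
Lemma special_family_opp : special_family alpha e ->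
  special_family alpha (fun i => - e i).
Proof.
move=> [h1 h2 h3 [h4 h4'] h5 h6]; split=> //.
- split=> [i /eqP|m]; first by rewrite oppr_eq0 => /eqP; exact: h4.
  under eq_bigr do rewrite mulNrz.
  rewrite sumrN => /eqP; rewrite oppr_eq0 => /eqP/h4' h i.
  by rewrite mulNrz h oppr0.
- by move=> i n; rewrite mulNrn => /eqP; rewrite oppr_eq0 => /eqP/h5.
- by rewrite sumrN h6 mulNrn.
Qed.

Lemma pm_atoms_opp : pm_atoms alpha (fun i => - e i) = pm_atoms alpha e.
Proof.
have E : (fun i => - - e i) = e by apply/funext => i; rewrite opprK.
have EU : seqU (fun i => - e i) = seqU e.
  by apply/funext => i; rewrite /seqU opprK addrC.
rewrite /pm_atoms mset_opp_seqV E -mset_opp_seqV EU; congr (_ `|` _).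
by rewrite classical_sets.setUC.
Qed.

End OppositeFamily.

Section TameSequences.
Variable G : zmodType.
Variables (r alpha : nat) (e : 'I_r.+1 -> G).
Hypothesis sf : special_family alpha e.

Let r_gt0 : (0 < r)%N. Proof. by case: sf. Qed.
Let alpha_gt0 : (0 < alpha)%N. Proof. by case: sf. Qed.
Let r_alpha : (2 < r + alpha)%N. Proof. by case: sf. Qed.

Local Notation GP := (pm_classes e).
Local Notation V := (seqV alpha e).
Local Notation W := (mset_opp (seqV alpha e)).
Local Notation U := (seqU e).
Local Notation At := (pm_atoms alpha e).
Local Notation lf := (lift ord0).
Local Notation D := (r + alpha)%N.

Lemma mset_facts_length2 S z : mset_facts At S z -> (2 * mlength z <= mlength S)%N.
Proof.
move=> [Fz <-]; elim/mset_ind: z Fz => [|A z IH] Fz; first by rewrite mlength0.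
move: Fz => /FabD[/Fab1/(pm_atoms_length sf)/andP[l2 _] /IH].
by rewrite big_mset_add big_mset_single !mlengthD mlength1 mulnDr; exact: leq_add.
Qed.

(** If V occurs in [z], remove it. If not, the terms of V alone require alpha copies of U_0 and one
    of each U_t, which leaves no room for -V. Then |V| + |T| = 2|z|, so |T| is at most r + alpha,
    and atoms have length at least 2. *)
Lemma tame_seqV T z : mset_facts At (V + T) z -> (mlength z <= D)%N ->
  exists2 z', mset_facts At T z' & (mlength z' < D)%N.
Proof.
move=> hz lz; have [zV|zV] := posnP (z V); last first.
  have /mset_pick[z' Ez] : V \in z by rewrite in_mset.
  exists z'; last by move: lz; rewrite Ez mlengthD mlength1.
  case: hz; rewrite Ez => /FabD[_ Fz']; rewrite big_mset_add big_mset_single.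
  by move=> /mset_addIr.
have [_ h2 h3 _] := zfact_counts sf hz.
have s_ge : (r <= \sum_(t < r) z (U (lf t)))%N.
  rewrite -[X in (X <= _)%N](card_ord r) -sum1_card; apply: leq_sum => t _.
  by have := h3 t; rewrite mset_addE !(atE sf) zV; lia.
have lE := zfact_length sf hz.
rewrite mset_addE !(atE sf) zV in h2.
have zW : z W = 0%N by lia.
have lS : mlength (V + T) = (2 * mlength z)%N.
  case: hz => Fz <-; rewrite {1 2}(zform_count sf Fz) zform_sum mlength_zform zV zW.
  rewrite !mulr0n !add0r mlength_sum big_distrr /=; apply: eq_bigr => i _.
  by rewrite mlengthMn mlengthU.
have zT : zero_sum GP T.
  by apply: zero_sum_sub (zfact_zero_sum sf hz); exact/(pm_atoms_zero_sum sf)/pm_atomsV.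
have [z' hz'] := zfact_exists sf zT; exists z' => //.
have := mset_facts_length2 hz'; move: lS; rewrite mlengthD mlengthV; lia.
Qed.

End TameSequences.

Section OmegaTame.
Variables (Q : choiceType) (G : zmodType) (c : Q -> G).
Variables (r alpha : nat) (e : 'I_r.+1 -> G).
Hypothesis sf : special_family alpha e.

Let r_gt0 : (0 < r)%N. Proof. by case: sf. Qed.
Let alpha_gt0 : (0 < alpha)%N. Proof. by case: sf. Qed.
Let r_alpha : (2 < r + alpha)%N. Proof. by case: sf. Qed.

Local Notation GP := (pm_classes e).
Local Notation V := (seqV alpha e).
Local Notation W := (mset_opp (seqV alpha e)).
Local Notation U := (seqU e).
Local Notation At := (pm_atoms alpha e).
Local Notation lf := (lift ord0).
Local Notation D := (r + alpha)%N.

Lemma mem_splitVW A : A \in splitVW alpha e -> exists i, A = U i.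
Proof.
move=> hA; have [[EA|EA]|[i _ <-]] := (splitVW_facts sf).1 A hA; last by exists i.
  by move: hA; rewrite EA in_mset (zform_V sf).
by move: hA; rewrite EA in_mset (zform_W sf).
Qed.

Variables (R : realType) (M : nmodType) (psi : M -> {mset Q}).
Hypothesis tm : transfer_map c GP psi.
Hypothesis c_surj : forall g, GP g -> exists q, c q = g.
Local Notation beta a := (mset_map c (psi a)).
Implicit Types a u : M.

Lemma atom_beta u : matom u <-> At (beta u).
Proof. by rewrite (transfer_atom tm) (min_zero_sum_pm sf). Qed.

Lemma atom_cover u n (v : 'I_n -> M) : mdvd u (\sum_i v i) ->
  exists2 Om : {set 'I_n}, (#|Om| <= mlength (beta u))%N & mdvd u (\sum_(i in Om) v i).
Proof.
move=> [b Eb]; have [|Om cOm dOm] := @mset_cover Q _ (fun i => psi (v i)) (psi u).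
  by rewrite -(transfer_sum tm) Eb (tmD tm); exists (psi b).
exists Om; first by rewrite mlength_map.
by apply: (tm_div tm); rewrite (transfer_sum tm).
Qed.

Lemma omega_bound_D u : matom u -> omega_bound u D.
Proof.
move=> /atom_beta/(pm_atoms_length sf)/andP[_ le] n v _ /atom_cover[Om cOm dOm].
by exists Om => //; exact: leq_trans le.
Qed.

(** An atom [u] over V divides a product of atoms over U_0^alpha U_1 ... U_r, and no factor can be
    spared. *)
Lemma omega_tame_witness : exists u n (v : 'I_n -> M),
  [/\ matom u, forall i, matom (v i), mdvd u (\sum_i v i),
      forall i, ~ massoc (v i) u &
      forall Om : {set 'I_n}, mdvd u (\sum_(i in Om) v i) -> (D <= #|Om|)%N].
Proof.
have sE := splitVW_facts sf.
have zS := zfact_zero_sum sf sE.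
have [a Ea] := transfer_surj tm c_surj zS.
have [u [w [Euw Eu _]]] := transfer_split tm (pm_atoms_zero_sum sf (pm_atomsV alpha e)) Ea.
have s_neq0 : (splitVW alpha e : seq {mset G}) <> [::].
  by move=> s0; have := mlength_splitVW sf; rewrite /mlength s0 /=; lia.
have s_min A : A \in splitVW alpha e -> min_zero_sum GP A.
  by rewrite (min_zero_sum_pm sf) => /sE.1.
have [|t [ht Et Eat]] := transfer_lift_atoms tm (a := a) s_neq0 s_min.
  by rewrite Ea sE.2.
have hU x : x \in t -> exists i, beta x = U i.
  by move=> /(map_f (fun x => beta x)); rewrite Et => /mem_splitVW.
exists u, (size t), (fun i => nth 0 t i); split.
- by apply/atom_beta; rewrite Eu; exact: pm_atomsV.
- by move=> i; apply: ht; rewrite mem_nth.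
- exists w; rewrite -Euw Eat (big_nth 0) big_mkord.
  by apply: eq_bigr.
- move=> i /asboolP[f /(transfer_unit tm) f0 Ef].
  have [j Ej] := hU _ (mem_nth 0 (ltn_ord i)).
  have : beta u = U j by rewrite Ef (tmD tm) f0 addr0.
  by rewrite Eu => /eqP; rewrite (seqV_neqU sf).
move=> Om [b Eb].
(* An additive weight counting the terms that occur in V: it is r + alpha on V and 1 on every
   U_j. *)
pose f (S : {mset G}) := (S (- e ord0) + \sum_(s < r) S (e (lf s)))%N.
have fD S T : f (S + T) = (f S + f T)%N.
  rewrite /f mset_addE; under eq_bigr do rewrite mset_addE.
  by rewrite big_split /=; lia.
have fV : f V = D.
  rewrite /f (atE sf); under eq_bigr do rewrite (atE sf).
  by rewrite sum_nat_const card_ord muln1 addnC.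
have fU j : f (U j) = 1%N.
  rewrite /f (atE sf); under eq_bigr do rewrite (atE sf).
  elim/ord_caseP: j => [|s]; first by rewrite big1.
  rewrite (bigD1 s) //= eqxx big1 // => s' /negPf ne.
  by rewrite lf_eq ne.
have f0 : f 0 = 0%N by rewrite /f mset_zeroE big1 // => s _; rewrite mset_zeroE.
have : f (beta (\sum_(i in Om) nth 0 t i)) = #|Om|.
  rewrite (transfer_sum tm) mset_map_sum (big_morph f fD f0) -sum1_card.
  by apply: eq_bigr => i _; have [j ->] := hU _ (mem_nth 0 (ltn_ord i)).
by rewrite Eb (tmD tm) mset_mapD fD Eu fV => <-; rewrite leq_addr.
Qed.

Lemma tame_bound_D u : matom u -> tame_bound u D.
Proof.
move=> /atom_beta hu n v hv dv nas.
have [_ lu] := andP (pm_atoms_length sf hu).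
have [Om cOm [b Eb]] := atom_cover dv.
have Ebeta : \sum_(i in Om) beta (v i) = beta u + beta b.
  by rewrite -mset_map_sum -(transfer_sum tm) Eb (tmD tm) mset_mapD.
pose z0 : {mset {mset G}} := \sum_(i in Om) [mset (beta (v i))].
have hz0 : mset_facts At (beta u + beta b) z0.
  split; first by apply: Fab_sum => i _; apply/Fab1/atom_beta.
  rewrite -Ebeta big_mset_sum; apply: eq_bigr => i _.
  by rewrite big_mset_single.
have lz0 : mlength z0 = #|Om|.
  by rewrite mlength_sum -sum1_card; apply: eq_bigr => i _; rewrite mlength1.
have zb := transfer_zero_sum tm b.
have lOm : (#|Om| <= D)%N by exact: leq_trans cOm lu.
have [z [Fz Ez] lz] : exists2 z, mset_facts At (beta b) z & (mlength z < D)%N.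
  case: (hu) => [[EV|EW]|[j _ EU]].
  - by apply: (tame_seqV sf (z := z0)); rewrite -?EV ?lz0.
  - have := @tame_seqV _ _ _ _ (special_family_opp sf) (beta b) z0.
    by rewrite pm_atoms_opp -mset_opp_seqV -EW lz0; exact.
  (* For U_j the cover has at most 2 atoms, so the complement has length at most 2(r + alpha) -
     2. *)
  have [z hz] := zfact_exists sf zb; exists z => //.
  have : (mlength (\sum_(i in Om) beta (v i))%R <= #|Om| * D)%N.
    rewrite mlength_sum -sum_nat_const; apply: leq_sum => i _.
    by have /atom_beta/(pm_atoms_length sf)/andP[] := hv i.
  have := mset_facts_length2 sf hz; rewrite Ebeta mlengthD; move: cOm; rewrite -EU mlengthU.
  by nia.
(* Some factor is needed to absorb the unit of the lift. If [b] were a unit, some [v i] would divide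
   the atom [u] and hence be associated to it. *)
have z_neq0 : (z : seq {mset G}) <> [::].
  move=> z0E; have b0 : psi b = 0.
    by move: Ez; rewrite z0E big_nil => /esym/mset_map_eq0.
  have [i iOm] : exists i, i \in Om.
    apply/set0Pn; apply/eqP => Om0; apply: (pm_atoms_neq0 sf hu).
    by move: Ebeta; rewrite Om0 big_set0 b0 mset_map0 addr0.
  have dvi : mdvd (psi (v i)) (psi u).
    have -> : psi u = \sum_(i in Om) psi (v i).
      by rewrite -(transfer_sum tm) Eb (tmD tm) b0 addr0.
    by rewrite (bigD1 i) //=; exists (\sum_(j in Om | j != i) psi (v j)).
  apply: (nas i); apply/asboolP; apply: (transfer_assoc tm).
  apply: (mset_dvd_length_eq dvi); rewrite -!(mlength_map c); congr mlength.
  apply: (pm_atoms_anti sf) => //; first exact/atom_beta.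
  by case: dvi => C ->; rewrite mset_mapD; exists (mset_map c C).
have [|w [hw Ew Ebw]] := @transfer_lift_atoms _ _ _ _ _ _ tm b z z_neq0 _ (esym Ez).
  by move=> A; rewrite (min_zero_sum_pm sf); exact: Fz.
exists Om, w; split=> //; first by rewrite Eb Ebw.
rewrite geq_max lOm andbT; move: lz; rewrite /mlength -Ew size_map; lia.
Qed.

Lemma omega_invariantE : omega_invariant R M = (D%:R)%:E.
Proof.
have [u [n [v [hu hv dv _ h]]]] := omega_tame_witness.
apply: ereal_sup_max; last first.
  by move=> _ [u' hu' <-]; apply: nat_inf_le; exact: omega_bound_D.
exists u => //; apply: nat_inf_min; first exact: omega_bound_D.
by move=> m /(_ n v hv dv)[Om cOm /h le]; exact: leq_trans cOm.
Qed.

Lemma tame_degreeE : tame_degree R M = (D%:R)%:E.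
Proof.
have [u [n [v [hu hv dv nas h]]]] := omega_tame_witness.
apply: ereal_sup_max; last first.
  by move=> _ [u' hu' <-]; apply: nat_inf_le; exact: tame_bound_D.
exists u => //; apply: nat_inf_min; first exact: tame_bound_D.
move=> m /(_ n v hv dv nas)[Om [w [hw E le]]].
have /h hD : mdvd u (\sum_(i in Om) v i) by exists (\sum_(x <- w) x).
by move: le; rewrite geq_max => /andP[_]; exact: leq_trans.
Qed.

End OmegaTame.

(** * Assembly of the results for H *)

Section KrullLengths.
Variables (Q : choiceType) (G : zmodType) (c : Q -> G).
Variables (r alpha : nat) (e : 'I_r.+1 -> G).
Hypothesis sf : special_family alpha e.
Variables (M : nmodType) (psi : M -> {mset Q}).
Hypothesis tm : transfer_map c (pm_classes e) psi.
Hypothesis c_surj : forall g, pm_classes e g -> exists q, c q = g.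

Lemma length_systemE :
  length_system M = [set L | exists m k, L = length_AP (r + alpha - 2) m k].
Proof.
apply/seteqP; split=> L.
  move=> [a _ <-]; rewrite (lengths_transfer tm) (min_zero_sum_pm sf).
  exact/(zlengths_AP sf)/(transfer_zero_sum tm).
move=> [m [k ->]]; have [S hS <-] := length_AP_ex sf m k.
have [a <-] := transfer_surj tm c_surj hS.
by exists a => //; rewrite (lengths_transfer tm) (min_zero_sum_pm sf).
Qed.

End KrullLengths.

Lemma davenportE (R : realType) (G : zmodType) (r alpha : nat) (e : 'I_r.+1 -> G) :
  special_family alpha e -> davenport R (pm_classes e) = ((r + alpha)%:R)%:E.
Proof.
move=> sf; rewrite /davenport zero_sum_atomsE (min_zero_sum_pm sf).
apply: nat_sup_max.
  by exists (seqV alpha e); [exact: pm_atomsV|rewrite mlengthV].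
by move=> _ [A /(pm_atoms_length sf)/andP[_ le] <-].
Qed.

Theorem theorem6p4 (R : realType) (H : nmodType) (H_canc : cancellative H)
    (P : choiceType) (phi : {additive H -> {mset P}})
    (phi_div : divisor_theory phi)
    (r alpha : nat) (r_gt0 : (0 < r)%N) (alpha_gt0 : (0 < alpha)%N)
    (r_alpha : (2 < r + alpha)%N)
    (e : 'I_r.+1 -> class_group phi)
    (GP_eq : prime_classes phi = range e `|` range (fun i => - e i))
    (e_indep : independent (fun i : 'I_r => e (lift ord0 i)))
    (e_inf : forall i : 'I_r, infinite_order (e (lift ord0 i)))
    (e_sum : \sum_(i < r) e (lift ord0 i) = e ord0 *+ alpha) :
  let GP := prime_classes phi in
  let V : {mset class_group phi} :=
    [mset (- e ord0)] *+ alpha + \sum_(i < r) [mset (e (lift ord0 i))] in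
  let U (nu : 'I_r.+1) : {mset class_group phi} :=
    [mset (- e nu)] + [mset (e nu)] in
  let D : \bar R := davenport R GP in
  let d : nat := (r + alpha - 2)%N in
  (* (1) *)
  (zero_sum_atoms GP = [set V; mset_opp V] `|` range U /\
   D = ((r + alpha)%:R)%:E) /\
  (* (2) *)
  (forall k l : 'I_r.+1 -> nat,
     let S : {mset class_group phi} :=
       \sum_(i < r.+1) ([mset (e i)] *+ k i + [mset (- e i)] *+ l i) in
     (zero_sum GP S <->
      forall i : 'I_r, (l (lift ord0 i))%:R =
        alpha%:R^-1 * ((k ord0)%:R - (l ord0)%:R) + (k (lift ord0 i))%:R :> rat)
     /\
     (zero_sum GP S -> (l ord0 <= k ord0)%N ->
      forall kstar : nat, is_min (range (fun i : 'I_r => k (lift ord0 i))) kstar ->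
      let q : nat := ((k ord0 - l ord0) %/ alpha)%N in
      let J : set nat :=
        [set nu : nat |
          (nu%:R : rat) <= Num.min (alpha%:R^-1 * (l ord0)%:R) kstar%:R] in
      zero_sum_factorizations GP S =
        [set [mset V] *+ nu + [mset (mset_opp V)] *+ (q + nu)
             + [mset (U ord0)] *+ (l ord0 - alpha * nu)
             + \sum_(i < r) [mset (U (lift ord0 i))] *+ (k (lift ord0 i) - nu)
        | nu in J] /\
      zero_sum_lengths GP S =
        [set (q + l ord0 + \sum_(i < r) k (lift ord0 i) - d * nu)%N
        | nu in J])) /\
  (* (3) *)
  (* (a) *) distance_set H = [set d] /\
  (* (b) *) elasticity R H = (D / 2%:E)%E /\
  (* (c) *) (forall k : nat, (0 < k)%N -> is_AP d (unions_of_lengths H k)) /\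
  (* (d) *) (forall k j : nat, (0 < k)%N -> (j <= 1)%N ->
       rho_ R H (2 * k + j) = ((k%:R)%:E * D + (j%:R)%:E)%E) /\
  (* (e) *) (forall l j n : nat, ((j%:R)%:E <= D - 1)%E ->
       (n%:R)%:E = ((l%:R)%:E * D + (j%:R)%:E)%E -> (1 <= n)%N ->
       lambda_ R H n = ((2 * l + j)%:R)%:E) /\
  (* (f) *) length_system H =
     [set L | exists m kstar : nat,
        L = [set (m + (2 * kstar + d * lam))%N
            | lam in [set lam | (lam <= kstar)%N]]] /\
  (* (4) *)
  [/\ catenary_degree R H = mon_catenary_degree R H,
      mon_catenary_degree R H = omega_invariant R H,
      omega_invariant R H = tame_degree R H,
      tame_degree R H = D &
      D = ((r + alpha)%:R)%:E].
Proof.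
move=> GP V U D d.
have sf : special_family alpha e by split.
have EGP : GP = pm_classes e by exact: GP_eq.
have tm : transfer_map (prime_class phi) (pm_classes e) phi.
  by rewrite -EGP; exact: krull_transfer.
have c_surj g : pm_classes e g -> exists p, prime_class phi p = g.
  by rewrite -EGP => -[p _ <-]; exists p.
have DE : D = ((r + alpha)%:R)%:E by rewrite /D EGP; exact: davenportE.
have systemE := length_systemE sf tm c_surj.
have d_gt0 : (0 < d)%N by rewrite subn_gt0.
have d2 : (d + 2 = r + alpha)%N by rewrite subnK // ltnW.
split; first by rewrite EGP zero_sum_atomsE (min_zero_sum_pm sf).
split.
  move=> k l S; rewrite EGP; split; first exact: (zero_sum_seqE sf).
  move=> hS lk kstar kstarP q J.
  rewrite zero_sum_factorizationsE // zero_sum_lengthsE // (min_zero_sum_pm sf).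
  split; first exact: (zfact_seqE sf).
  exact: (zlengths_seqE sf).
split; first exact: distance_setE.
split; first by rewrite (elasticityE _ d_gt0 systemE) d2 DE inver pnatr_eq0 EFinM.
split; first by move=> k _; exact: (unions_AP d_gt0 systemE).
split.
  move=> k j _ j1; rewrite (rhoE _ d_gt0 systemE) // d2 DE -EFinM -EFinD.
  by rewrite natrD natrM.
split.
  move=> l j n; rewrite DE -EFinM -EFinD => hj [] hn _.
  (* The bound of [j] by D - 1 in the extended reals, read back in the natural numbers. *)
  have j_lt : (j < d + 2)%N.
    have : ((j%:R : R)%:E <= ((r + alpha)%:R - 1 : R)%:E)%E by exact: hj.
    by rewrite d2 lee_fin lerBrDr natr1 ler_nat.
  have -> : n = (l * (d + 2) + j)%N.
    by apply/eqP; rewrite d2 -(eqr_nat R) hn [X in _ == X]natrD natrM.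
  exact: (lambdaE _ d_gt0 systemE).
split; first by rewrite systemE.
rewrite (catenary_degreeE sf R tm c_surj) (mon_catenary_degreeE sf R tm c_surj).
by rewrite (omega_invariantE sf R tm c_surj) (tame_degreeE sf R tm c_surj) DE.
Qed.
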